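(* Let $M$ be a 4-dimensional LP-Sasakian manifold which is conformally flat, quasi conformally flat or conformally symmetric, and let $\gamma:I\to M$ be a spacelike curve parametrized by arclength. Suppose that $\{T,N,B_1,B_2\}$ is a moving Frenet frame along $\gamma$ such that $N$ is a null vector. Then $\gamma$ is a biharmonic curve if and only if $\gamma$ is a geodesic of $M$.
   Context: LP-Sasakian manifold: an $n$-dimensional smooth manifold $M$ with a $(1,1)$-tensor field $\phi$, a vector field $\xi$, a 1-form $\eta$ and a Lorentzian metric $g$ of signature $(-,+,\dots,+)$ such that $\eta(\xi)=-1$, $\phi^2=I+\eta\otimes\xi$, $g(\phi X,\phi Y)=g(X,Y)+\eta(X)\eta(Y)$ (so that $g(X,\xi)=\eta(X)$), and $(\nabla_X\phi)Y=g(\phi X,\phi Y)\xi+\eta(Y)\phi^2X$ for all vector fields $X,Y$, where $\nabla$ is the Levi-Civita connection of $g$. Curvature: $R(X,Y)=[\nabla_X,\nabla_Y]-\nabla_{[X,Y]}$; $S$ is the Ricci tensor, $Q$ is given by $S(X,Y)=g(QX,Y)$, and $r$ is the scalar curvature. The conformal curvature tensor is $C(X,Y)Z=R(X,Y)Z-\frac{1}{n-2}\{g(Y,Z)QX-g(X,Z)QY+S(Y,Z)X-S(X,Z)Y\}+\frac{r}{(n-1)(n-2)}\{g(Y,Z)X-g(X,Z)Y\}$. The quasi-conformal curvature tensor is $\widetilde C(X,Y)Z=aR(X,Y)Z+b\{S(Y,Z)X-S(X,Z)Y+g(Y,Z)QX-g(X,Z)QY\}-\frac{r}{n}\left(\frac{a}{n-1}+2b\right)\{g(Y,Z)X-g(X,Z)Y\}$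 with constants $a,b$, $ab\neq0$. $M$ is conformally flat if $C=0$, quasi conformally flat if $\widetilde C=0$ (for such constants), conformally symmetric if $\nabla C=0$. Here $n=4$. Curves: $I\subset\mathbb R$ is an interval, $T=\gamma'$, and $\gamma$ is spacelike parametrized by arclength if $g(T,T)=1$. $\gamma$ is biharmonic if $\nabla_T^3T-R(T,\nabla_TT)T=0$, and a geodesic if $\nabla_TT=0$. Frenet frame in this case: $g(T,T)=g(B_1,B_1)=1$, $g(N,N)=g(B_2,B_2)=0$, $g(N,B_2)=1$, $g(T,N)=g(T,B_1)=g(T,B_2)=g(N,B_1)=g(B_1,B_2)=0$, and $\nabla_TT=k_1N$, $\nabla_TN=k_2B_1$, $\nabla_TB_1=k_3N-k_2B_2$, $\nabla_TB_2=-k_1T-k_3B_1$, where the curvatures $k_1,k_2,k_3$ are smooth functions. By convention for a spacelike curve with null principal normal, the first curvature $k_1$ takes only the values $0$ (when $\gamma$ is a geodesic) and $1$ (otherwise). *)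

(* Defs.v *)
From HB Require Import structures.
From mathcomp Require Import all_boot all_order all_algebra.
From mathcomp Require Import all_classical all_reals all_analysis.

Set Implicit Arguments.
Unset Strict Implicit.
Unset Printing Implicit Defensive.

Import Order.TTheory GRing.Theory Num.Theory.
Import numFieldNormedType.Exports.

Local Open Scope classical_set_scope.
Local Open Scope ring_scope.

(* In finite dimension this is the usual class C^k (resp. C^oo) when A is
   open; functions are total and only their germs along A matter. *)
Fixpoint Ck_on (R : realType) (V W : normedModType R) (k : nat) (A : set V)
    (f : V -> W) : Prop :=
  match k with
  | 0 => forall x, A x -> {for x, continuous f}
  | k'.+1 => (forall x, A x -> differentiable f x) /\
             (forall v, Ck_on k' A (fun x => 'D_v f x))
  end.

Definition smooth_on (R : realType) (V W : normedModType R) (A : set V)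
    (f : V -> W) : Prop :=
  forall k, Ck_on k A f.

Record chart (R : realType) (n : nat) (M : topologicalType) := Chart {
  cdom : set M;
  cmap : M -> 'rV[R]_n;
  cinv : 'rV[R]_n -> M;
  cdom_open : open cdom;
  cimg_open : open (cmap @` cdom);
  cmapK : forall p, cdom p -> cinv (cmap p) = p;
  cmap_continuous : forall p, cdom p -> {for p, continuous cmap};
  cinv_continuous : forall x, (cmap @` cdom) x -> {for x, continuous cinv}
}.

Definition cimg (R : realType) (n : nat) (M : topologicalType)
    (c : chart R n M) : set 'rV[R]_n := cmap c @` cdom c.

Definition overlap (R : realType) (n : nat) (M : topologicalType)
    (c d : chart R n M) : set 'rV[R]_n :=
  cimg c `&` [set x | cdom d (cinv c x)].

Definition transition (R : realType) (n : nat) (M : topologicalType)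
    (c d : chart R n M) : 'rV[R]_n -> 'rV[R]_n :=
  cmap d \o cinv c.

Record smooth_manifold (R : realType) (n : nat) := SmoothManifold {
  carrier :> topologicalType;
  atlas : Type;
  mchart : atlas -> chart R n carrier;
  carrier_hausdorff : hausdorff_space carrier;
  carrier_second_countable : @second_countable carrier;
  atlas_cover : forall p : carrier, exists c, cdom (mchart c) p;
  transition_smooth : forall c d,
    smooth_on (overlap (mchart c) (mchart d))
              (transition (mchart c) (mchart d))
}.

(* A tensor field is the family of its component functions in the charts of
   the atlas, subject to the tensorial change-of-chart law.  Vectors are rows:
   phi(u) = u *m phi, g(u, v) = u *m g *m v^T, eta(u) = u *m eta, and the
   differential of f at x maps u to u *m 'J f x. *)
Section TensorFields.
Context (R : realType) (n : nat) (M : smooth_manifold R n).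

Let J (c d : atlas M) (x : 'rV[R]_n) : 'M[R]_n :=
  jacobian (transition (mchart c) (mchart d)) x.
Let tau (c d : atlas M) := transition (mchart c) (mchart d).
Let ov (c d : atlas M) := overlap (mchart c) (mchart d).

Definition is_vector_field (X : atlas M -> 'rV[R]_n -> 'rV[R]_n) : Prop :=
  (forall c, smooth_on (cimg (mchart c)) (X c)) /\
  (forall c d x, ov c d x -> X d (tau c d x) = X c x *m J c d x).

Definition is_one_form (a : atlas M -> 'rV[R]_n -> 'cV[R]_n) : Prop :=
  (forall c, smooth_on (cimg (mchart c)) (a c)) /\
  (forall c d x, ov c d x -> a c x = J c d x *m a d (tau c d x)).

Definition is_tensor11 (F : atlas M -> 'rV[R]_n -> 'M[R]_n) : Prop :=
  (forall c, smooth_on (cimg (mchart c)) (F c)) /\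
  (forall c d x, ov c d x -> F c x *m J c d x = J c d x *m F d (tau c d x)).

Definition is_tensor02 (h : atlas M -> 'rV[R]_n -> 'M[R]_n) : Prop :=
  (forall c, smooth_on (cimg (mchart c)) (h c)) /\
  (forall c d x, ov c d x ->
     h c x = J c d x *m h d (tau c d x) *m (J c d x)^T).

Definition lorentz_signature (A : 'M[R]_n) : Prop :=
  exists2 P : 'M[R]_n, P \in unitmx &
    P *m A *m P^T =
      diag_mx (\row_(i < n) (if (i == 0 :> nat)%N then -1 else 1)).

Definition is_lorentz_metric (g : atlas M -> 'rV[R]_n -> 'M[R]_n) : Prop :=
  is_tensor02 g /\
  (forall c x, cimg (mchart c) x -> (g c x)^T = g c x /\
                                    lorentz_signature (g c x)).

End TensorFields.

(* Tensor calculus on a coordinate domain of R^n.  G x i j is the vector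
   nabla_{d_i} d_j at x, so its k-th entry is the Christoffel symbol
   Gamma^k_{ij}(x). *)
Section LocalGeometry.
Context (R : realType) (n : nat).
Implicit Types (X Y Z W : 'rV[R]_n -> 'rV[R]_n) (x u v w : 'rV[R]_n).

Definition bil (A : 'M[R]_n) u v : R := (u *m A *m v^T) 0 0.
Definition ev (a : 'cV[R]_n) u : R := (u *m a) 0 0.

Definition gamma_at (G : 'I_n -> 'I_n -> 'rV[R]_n) u v : 'rV[R]_n :=
  \sum_(i < n) \sum_(j < n) (u 0 i * v 0 j) *: G i j.

Definition bracket X Y : 'rV[R]_n -> 'rV[R]_n :=
  fun x => 'D_(X x) Y x - 'D_(Y x) X x.

Section WithConnection.
Variable G : 'rV[R]_n -> 'I_n -> 'I_n -> 'rV[R]_n.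

Definition cov X Y : 'rV[R]_n -> 'rV[R]_n :=
  fun x => 'D_(X x) Y x + gamma_at (G x) (X x) (Y x).

Definition curv X Y Z : 'rV[R]_n -> 'rV[R]_n :=
  fun x => cov X (cov Y Z) x - cov Y (cov X Z) x - cov (bracket X Y) Z x.

(* The curvature on tangent vectors at x, computed on their extensions with
   constant components; it is tensorial, so any extensions would do. *)
Definition curv_at x u v w : 'rV[R]_n :=
  curv (cst u) (cst v) (cst w) x.

(* S(Y,Z) = tr (X |-> R(X,Y)Z). *)
Definition ricci x : 'M[R]_n :=
  \matrix_(i, j) \sum_(k < n)
    curv_at x (delta_mx 0 k) (delta_mx 0 i) (delta_mx 0 j) 0 k.

Variable g : 'rV[R]_n -> 'M[R]_n.

(* With row vectors, S(u,v) = g(Qu,v) reads ricci = Q *m g. *)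
Definition ricci_op x : 'M[R]_n := ricci x *m invmx (g x).

Definition scal x : R := \tr (ricci_op x).

Definition ricci_part X Y Z : 'rV[R]_n -> 'rV[R]_n := fun x =>
  bil (g x) (Y x) (Z x) *: (X x *m ricci_op x)
  - bil (g x) (X x) (Z x) *: (Y x *m ricci_op x)
  + bil (ricci x) (Y x) (Z x) *: X x
  - bil (ricci x) (X x) (Z x) *: Y x.

Definition metric_part X Y Z : 'rV[R]_n -> 'rV[R]_n := fun x =>
  bil (g x) (Y x) (Z x) *: X x - bil (g x) (X x) (Z x) *: Y x.

Definition conformal X Y Z : 'rV[R]_n -> 'rV[R]_n := fun x =>
  curv X Y Z x
  - (n%:R - 2)^-1 *: ricci_part X Y Z x
  + (scal x / ((n%:R - 1) * (n%:R - 2))) *: metric_part X Y Z x.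

Definition quasi_conformal (a b : R) X Y Z : 'rV[R]_n -> 'rV[R]_n := fun x =>
  a *: curv X Y Z x
  + b *: ricci_part X Y Z x
  - (scal x / n%:R * (a / (n%:R - 1) + 2 * b)) *: metric_part X Y Z x.

Definition nabla_conformal W X Y Z : 'rV[R]_n -> 'rV[R]_n := fun x =>
  cov W (conformal X Y Z) x
  - conformal (cov W X) Y Z x
  - conformal X (cov W Y) Z x
  - conformal X Y (cov W Z) x.

Definition levi_civita_on (A : set 'rV[R]_n) : Prop :=
  [/\ forall i j, smooth_on A (fun x => G x i j),
      forall X Y, smooth_on A X -> smooth_on A Y ->
        forall x, A x -> cov X Y x - cov Y X x = bracket X Y x
    & forall X Y Z, smooth_on A X -> smooth_on A Y -> smooth_on A Z ->
        forall x, A x ->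
        'D_(X x) (fun y => bil (g y) (Y y) (Z y) : R^o) x =
        bil (g x) (cov X Y x) (Z x) + bil (g x) (Y x) (cov X Z x)].

End WithConnection.
End LocalGeometry.

(* Identities between tensor fields are local, so vector fields X, Y, ...
   range over the smooth vector fields on each coordinate domain.  The
   Levi-Civita coefficients lp_nabla are uniquely determined by the metric in
   each chart, hence obey the transformation law of a connection. *)
Record lp_sasakian (R : realType) (n : nat) (M : smooth_manifold R n) :=
  LPSasakian {
  lp_phi : atlas M -> 'rV[R]_n -> 'M[R]_n;
  lp_xi : atlas M -> 'rV[R]_n -> 'rV[R]_n;
  lp_eta : atlas M -> 'rV[R]_n -> 'cV[R]_n;
  lp_g : atlas M -> 'rV[R]_n -> 'M[R]_n;
  lp_nabla : atlas M -> 'rV[R]_n -> 'I_n -> 'I_n -> 'rV[R]_n;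
  lp_phi_tensor : is_tensor11 lp_phi;
  lp_xi_field : is_vector_field lp_xi;
  lp_eta_form : is_one_form lp_eta;
  lp_g_metric : is_lorentz_metric lp_g;
  lp_nabla_levi_civita : forall c,
    levi_civita_on (lp_nabla c) (lp_g c) (cimg (mchart c));
  lp_eta_xi : forall c x, cimg (mchart c) x -> ev (lp_eta c x) (lp_xi c x) = -1;
  lp_phi2 : forall c x, cimg (mchart c) x -> forall u,
    u *m lp_phi c x *m lp_phi c x = u + ev (lp_eta c x) u *: lp_xi c x;
  lp_g_phi : forall c x, cimg (mchart c) x -> forall u v,
    bil (lp_g c x) (u *m lp_phi c x) (v *m lp_phi c x) =
    bil (lp_g c x) u v + ev (lp_eta c x) u * ev (lp_eta c x) v;
  lp_nabla_phi : forall c (X Y : 'rV[R]_n -> 'rV[R]_n),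
    smooth_on (cimg (mchart c)) X -> smooth_on (cimg (mchart c)) Y ->
    forall x, cimg (mchart c) x ->
    cov (lp_nabla c) X (fun y => Y y *m lp_phi c y) x
      - cov (lp_nabla c) X Y x *m lp_phi c x =
    bil (lp_g c x) (X x *m lp_phi c x) (Y x *m lp_phi c x) *: lp_xi c x
      + ev (lp_eta c x) (Y x) *: (X x *m lp_phi c x *m lp_phi c x)
}.

Section Flatness.
Context (R : realType) (n : nat) (M : smooth_manifold R n).
Variable L : lp_sasakian M.
Implicit Types X Y Z W : 'rV[R]_n -> 'rV[R]_n.

Definition conformally_flat : Prop :=
  forall (c : atlas M) X Y Z,
    smooth_on (cimg (mchart c)) X -> smooth_on (cimg (mchart c)) Y ->
    smooth_on (cimg (mchart c)) Z ->
    forall x, cimg (mchart c) x ->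
      conformal (lp_nabla L c) (lp_g L c) X Y Z x = 0.

Definition quasi_conformally_flat : Prop :=
  exists a b : R, a * b != 0 /\
  forall (c : atlas M) X Y Z,
    smooth_on (cimg (mchart c)) X -> smooth_on (cimg (mchart c)) Y ->
    smooth_on (cimg (mchart c)) Z ->
    forall x, cimg (mchart c) x ->
      quasi_conformal (lp_nabla L c) (lp_g L c) a b X Y Z x = 0.

Definition conformally_symmetric : Prop :=
  forall (c : atlas M) W X Y Z,
    smooth_on (cimg (mchart c)) W -> smooth_on (cimg (mchart c)) X ->
    smooth_on (cimg (mchart c)) Y -> smooth_on (cimg (mchart c)) Z ->
    forall x, cimg (mchart c) x ->
      nabla_conformal (lp_nabla L c) (lp_g L c) W X Y Z x = 0.

End Flatness.

(* A curve gam defined on an interval I is smooth when it extends smoothly to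
   an open set U containing I (U = I if I is open); at an endpoint of I the
   derivatives below are those of the extension, i.e. the one-sided ones.  A
   field V along gam is given by its components V c t, which are meaningful
   when gam t lies in the domain of the chart c. *)
Section Curves.
Context (R : realType) (n : nat) (M : smooth_manifold R n).
Variable L : lp_sasakian M.
Variable gam : R -> M.
Implicit Types (I U : set R) (V W : atlas M -> R -> 'rV[R]_n) (f : R -> R).

Definition in_chart (c : atlas M) : set R := [set t | cdom (mchart c) (gam t)].

Definition coords (c : atlas M) : R -> 'rV[R]_n := cmap (mchart c) \o gam.

Definition smooth_curve U : Prop :=
  (forall t, U t -> {for t, continuous gam}) /\
  (forall c, smooth_on (U `&` in_chart c : set R^o) (coords c)).

Definition field_along U V : Prop :=
  (forall c, smooth_on (U `&` in_chart c : set R^o) (V c)) /\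
  (forall c d t, U t -> in_chart c t -> in_chart d t ->
     V d t = V c t *m jacobian (transition (mchart c) (mchart d)) (coords c t)).

Definition eq_along I V W : Prop :=
  forall c t, I t -> in_chart c t -> V c t = W c t.

Definition inner_along I V W (a : R) : Prop :=
  forall c t, I t -> in_chart c t ->
    bil (lp_g L c (coords c t)) (V c t) (W c t) = a.

Definition velocity : atlas M -> R -> 'rV[R]_n :=
  fun c t => derive1 (coords c) t.

Definition cov_along V : atlas M -> R -> 'rV[R]_n :=
  fun c t => derive1 (V c) t +
    gamma_at (lp_nabla L c (coords c t)) (velocity c t) (V c t).

Definition curv_along V1 V2 V3 : atlas M -> R -> 'rV[R]_n :=
  fun c t => curv_at (lp_nabla L c) (coords c t) (V1 c t) (V2 c t) (V3 c t).

Definition scale_along f V : atlas M -> R -> 'rV[R]_n :=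
  fun c t => f t *: V c t.

Definition add_along V W : atlas M -> R -> 'rV[R]_n :=
  fun c t => V c t + W c t.

Definition zero_along : atlas M -> R -> 'rV[R]_n := fun _ _ => 0.

Definition geodesic I : Prop := eq_along I (cov_along velocity) zero_along.

Definition biharmonic I : Prop :=
  eq_along I
    (fun c t => cov_along (cov_along (cov_along velocity)) c t
                - curv_along velocity (cov_along velocity) velocity c t)
    zero_along.

Definition spacelike_unit_speed I : Prop := inner_along I velocity velocity 1.

Record null_frenet_frame I U (N B1 B2 : atlas M -> R -> 'rV[R]_n)
    (k1 k2 k3 : R -> R) : Prop := NullFrenetFrame {
  frenet_N : field_along U N;
  frenet_B1 : field_along U B1;
  frenet_B2 : field_along U B2;
  frenet_k1 : smooth_on (U : set R^o) (k1 : R^o -> R^o);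
  frenet_k2 : smooth_on (U : set R^o) (k2 : R^o -> R^o);
  frenet_k3 : smooth_on (U : set R^o) (k3 : R^o -> R^o);
  frenet_TT : spacelike_unit_speed I;
  frenet_B1B1 : inner_along I B1 B1 1;
  frenet_NN : inner_along I N N 0;
  frenet_B2B2 : inner_along I B2 B2 0;
  frenet_NB2 : inner_along I N B2 1;
  frenet_TN : inner_along I velocity N 0;
  frenet_TB1 : inner_along I velocity B1 0;
  frenet_TB2 : inner_along I velocity B2 0;
  frenet_NB1 : inner_along I N B1 0;
  frenet_B1B2 : inner_along I B1 B2 0;
  frenet_dT : eq_along I (cov_along velocity) (scale_along k1 N);
  frenet_dN : eq_along I (cov_along N) (scale_along k2 B1);
  frenet_dB1 : eq_along I (cov_along B1)
    (add_along (scale_along k3 N) (scale_along (fun t => - k2 t) B2));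
  frenet_dB2 : eq_along I (cov_along B2)
    (add_along (scale_along (fun t => - k1 t) velocity)
               (scale_along (fun t => - k3 t) B1))
}.

Definition first_curvature_convention I (k1 : R -> R) : Prop :=
  (geodesic I -> forall t, I t -> k1 t = 0) /\
  (~ geodesic I -> forall t, I t -> k1 t = 1).

End Curves.

(* Main.v *)
(* Write h = g + eta (x) eta for the metric on the distribution D orthogonal to
   xi.  Each of the three flatness hypotheses (a conformally symmetric M has
   R.C = 0, and R(xi, X) spans enough of the Lorentz algebra to force C = 0)
   makes the curvature of the form R = g /\ g + mu h /\ h with
   mu = scal / 6 - 2.  Constant curvature, i.e. mu = 0, does not follow: the
   metric -dt^2 + e^{2t} h_k, h_k of constant curvature k, is a conformally flat
   LP-Sasakian metric with mu = k e^{-2t}.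

   Let k1 = 1 and let gamma be biharmonic; a, b, c, d are the values of eta on
   T, N, B1, B2.  The biharmonic equation reads k2^2 = mu b^2,
   k2' = - mu b c, k2 k3 = - 1 - mu (1 + b d + a^2); in particular mu <> 0, and
   b <> 0 since xi is timelike.  Where mu <> 0 the second Bianchi identity forces
   phi = eps h with eps = 1 or -1, and d mu = 2 eps mu eta along gamma.
   Differentiating k2^2 = mu b^2 gives k2 c = - eps a b, hence b' = 0;
   differentiating once more gives eps b^2 = 0, a contradiction. *)
Require Import Defs.
From mathcomp Require Import all_boot all_order all_algebra.
From mathcomp Require Import all_classical all_reals all_analysis.
From mathcomp Require Import ring lra.

Set Implicit Arguments.
Unset Strict Implicit.
Unset Printing Implicit Defensive.

Import Order.TTheory GRing.Theory Num.Theory.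
Import numFieldNormedType.Exports.

Local Open Scope classical_set_scope.
Local Open Scope ring_scope.

(** * Calculus of C^k functions *)

(** The sign [eps] is produced separately at each point, so nothing makes it continuous a priori,
    while the last differentiation needs it constant. Since [nabla_T T = N] and
    [nabla_T xi = phi T], one has [a' = b + eps (1 + a^2)]; hence [eps = (a' - b) / (1 + a^2)] is
    differentiable along the curve, and [eps^2 = 1] makes its derivative vanish. That [phi] is a
    multiple of the identity on D comes from the shape of the curvature. The term [g /\ g] is
    parallel, so the Bianchi identity sees only [d mu] and [nabla h], and because [nabla xi = phi]
    the latter carries the entries of [phi]. As D has dimension 3, comparing its coordinate planes
    equates the diagonal entries and kills the others; [phi^2 = id] on D then gives [eps^2 = 1]. The
    Frenet equations hold on [I] alone, which may contain its endpoints and need not map into one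
    chart. The contradiction is therefore derived on an open subinterval inside a single chart,
    whereas the converse must treat endpoints, where derivatives are those of an extension beyond
    [I]. *)

Lemma near0_differentiable (R : realType) (V W : normedModType R) (z : V -> W) x :
  (\near x, z x = 0) -> differentiable z x.
Proof.
move=> z0; have zx : z x = 0 by exact: nbhs_singleton z0.
have H : z \o shift x = cst (z x) + (\0 : V -> W) +o_ 0 id.
  apply/eqaddoP => _/posnumP[e].
  have z0' : \forall y \near 0, z (y + x) = 0 by move: z0; rewrite (near_shift 0) subr0.
  near=> y.
  rewrite !fctE /= zx !addr0 subr0.
  by rewrite (near z0') // normr0 mulr_ge0.
have c0 : continuous (\0 : V -> W) by apply: cst_continuous.
apply/diff_locallyP; rewrite (diff_unique c0 H); split => //.
Unshelve. all: by end_near. Qed.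

Lemma near_eq_differentiable (R : realType) (V W : normedModType R) (f g : V -> W) x :
  (\near x, f x = g x) -> differentiable f x -> differentiable g x.
Proof.
move=> fg df; have -> : g = f + (g - f) by rewrite addrC subrK.
apply: differentiableD => //; apply: near0_differentiable.
by apply: filterS fg => y fy; rewrite -[LHS]/(g y - f y) fy subrr.
Qed.

Section SmoothCalculus.
Context (R : realType) (V : normedModType R).
Implicit Types (A B : set V) (x v : V) (k : nat).

Lemma Ck_cst (W : normedModType R) k A (a : W) : Ck_on k A (cst a).
Proof.
elim: k a => [|k IH] a /=; first by move=> x _; exact: cst_continuous.
split=> [x _|v]; first exact: differentiable_cst.
rewrite (_ : (fun x => _) = cst 0); first exact: IH.
by apply/funext => x; rewrite derive_cst.
Qed.

Lemma CkS (W : normedModType R) k A (f : V -> W) : Ck_on k.+1 A f -> Ck_on k A f.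
Proof.
elim: k f => [|k IH] f [df Df].
  by move=> x /df; exact: differentiable_continuous.
by split=> // v; apply: IH.
Qed.

Lemma Ck_differentiable (W : normedModType R) k A (f : V -> W) x :
  Ck_on k.+1 A f -> A x -> differentiable f x.
Proof. by move=> [+ _] => /[apply]. Qed.

Lemma eq_on_derive (W : normedModType R) A (f g : V -> W) x v : open A ->
  (forall x, A x -> f x = g x) -> A x -> 'D_v f x = 'D_v g x.
Proof.
move=> oA fg Ax; apply: near_eq_derive.
by apply: filterS (open_nbhs_nbhs (conj oA Ax)) => y /fg.
Qed.

(** The Leibniz formulas below hold only at points of [A], where differentiability is known.
    Openness of [A] lets them replace the derivative in an induction on [k] all the same. *)
Lemma eq_Ck (W : normedModType R) k A (f g : V -> W) : open A ->
  (forall x, A x -> f x = g x) -> Ck_on k A f -> Ck_on k A g.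
Proof.
move=> oA; elim: k f g => [|k IH] f g fg.
  move=> cf x Ax; have := cf x Ax.
  rewrite /prop_for /continuous_at -(fg x Ax) => h; apply: cvg_trans h.
  apply: near_eq_cvg; apply: filterS (open_nbhs_nbhs (conj oA Ax)) => y /fg.
  by [].
move=> [df Df]; split=> [x Ax|v].
  apply: near_eq_differentiable (df x Ax).
  by apply: filterS (open_nbhs_nbhs (conj oA Ax)) => y /fg.
by apply: (IH _ _ _ (Df v)) => x Ax; apply: eq_on_derive fg Ax.
Qed.

Lemma CkD (W : normedModType R) k A (f g : V -> W) : open A ->
  Ck_on k A f -> Ck_on k A g -> Ck_on k A (fun x => f x + g x).
Proof.
move=> oA; elim: k f g => [|k IH] f g.
  by move=> cf cg x Ax; apply: continuousD; [exact: cf|exact: cg].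
move=> [df Df] [dg Dg]; split=> [x Ax|v].
  exact: differentiableD (df _ Ax) (dg _ Ax).
apply: eq_Ck (IH _ _ (Df v) (Dg v)) => // x Ax.
by rewrite -deriveD //; apply: diff_derivable; [exact: df|exact: dg].
Qed.

Lemma CkZ (W : normedModType R) k A (a : R) (f : V -> W) : open A ->
  Ck_on k A f -> Ck_on k A (fun x => a *: f x).
Proof.
move=> oA; elim: k f => [|k IH] f.
  by move=> cf x Ax; apply: continuousZr; exact: cf.
move=> [df Df]; split=> [x Ax|v].
  exact: differentiableZ (df _ Ax).
apply: eq_Ck (IH _ (Df v)) => // x Ax.
by rewrite -deriveZ //; apply: diff_derivable; exact: df.
Qed.

Lemma Ck_sum (W : normedModType R) k A n (f : 'I_n -> V -> W) : open A ->
  (forall i, Ck_on k A (f i)) -> Ck_on k A (fun x => \sum_i f i x).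
Proof.
move=> oA fk; elim: n f fk => [|n IH] f fk.
  by apply: eq_Ck (Ck_cst _ _ 0) => // x _; rewrite big_ord0.
apply: (@eq_Ck _ _ _ (fun x => f ord0 x + \sum_i f (lift ord0 i) x)) => //.
  by move=> x _; rewrite big_ord_recl.
by apply: CkD => //; apply: IH.
Qed.

Lemma CkM k A (f g : V -> R) : open A ->
  Ck_on k A f -> Ck_on k A g -> Ck_on k A (fun x => f x * g x).
Proof.
move=> oA; elim: k f g => [|k IH] f g.
  by move=> cf cg x Ax; apply: continuousM; [exact: cf|exact: cg].
move=> fk gk; have [[df Df] [dg Dg]] := (fk, gk); split=> [x Ax|v].
  exact: differentiableM (df _ Ax) (dg _ Ax).
apply: (@eq_Ck _ _ _ (fun x => f x * 'D_v g x + g x * 'D_v f x)) => //.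
  by move=> x Ax; rewrite -deriveM //; apply: diff_derivable; [exact: df|exact: dg].
by apply: CkD => //; apply: IH; [exact: CkS|exact: Dg|exact: CkS|exact: Df].
Qed.

Lemma CkV k A (f : V -> R) : open A -> (forall x, A x -> f x != 0) ->
  Ck_on k A f -> Ck_on k A (fun x => (f x)^-1).
Proof.
move=> oA f0; elim: k => [|k IH].
  by move=> cf x Ax; apply: continuousV; [exact: f0|exact: cf].
move=> fk; have [df Df] := fk; split=> [x Ax|v].
  exact: differentiableV (df _ Ax) (f0 _ Ax).
have Vk := IH (CkS fk).
apply: (@eq_Ck _ _ _ (fun x => ((f x)^-1 * (f x)^-1) * (- 1 *: 'D_v f x))) => //.
  move=> x Ax; rewrite deriveV ?f0 //; last by apply: diff_derivable; exact: df.
  by rewrite expr2 invfM scaleN1r scaleNr -mulrN.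
by apply: CkM => //; [exact: CkM|apply: CkZ => //; exact: Df].
Qed.

Lemma mxE_coord m n (M : V -> 'M[R]_(m, n)) i j :
  (fun x => M x i j) = (fun N : 'M[R]_(m, n) => N i j) \o M.
Proof. by []. Qed.

Lemma differentiable_mxP m n (M : V -> 'M[R]_(m, n)) x :
  differentiable M x <-> forall i j, differentiable (fun y => M y i j) x.
Proof.
split=> [dM i j|dM].
  by rewrite mxE_coord; apply: differentiable_comp dM _; exact: differentiable_coord.
suff -> : M = \sum_(p < m) \sum_(q < n) ((fun y => M y p q *: delta_mx p q) : V -> 'M[R]_(m, n)).
  apply: differentiable_sum => p; apply: differentiable_sum => q.
  exact: differentiableZl.
apply/funext => y; rewrite fct_sumE [LHS]matrix_sum_delta.
by apply: eq_bigr => p _; rewrite fct_sumE.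
Qed.

Lemma derive_mxE m n (M : V -> 'M[R]_(m, n)) x v i j : differentiable M x ->
  ('D_v M x) i j = 'D_v (fun y => M y i j) x.
Proof. by move=> dM; rewrite derive_mx ?mxE //; exact: diff_derivable. Qed.

Lemma Ck_mxP k A m n (M : V -> 'M[R]_(m, n)) : open A ->
  Ck_on k A M <-> forall i j, Ck_on k A (fun y => M y i j).
Proof.
move=> oA; elim: k M => [|k IH] M; split.
- move=> cM i j x Ax; rewrite mxE_coord.
  apply: continuous_comp; first exact: cM.
  by apply: differentiable_continuous; exact: differentiable_coord.
- move=> cM.
  suff : Ck_on 0 A (fun y => \sum_(p < m) \sum_(q < n) M y p q *: delta_mx p q).
    by apply: eq_Ck => // x _; rewrite -matrix_sum_delta.
  apply: Ck_sum => // p; apply: Ck_sum => // q x Ax.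
  by apply: continuousZl; exact: cM.
- move=> [dM DM] i j; split=> [x Ax|v]; first by have /differentiable_mxP := dM x Ax.
  have /IH /(_ i j) := DM v; apply: eq_Ck => // x Ax.
  by rewrite derive_mxE //; exact: dM.
- move=> cM.
  have dM x : A x -> differentiable M x.
    by move=> Ax; apply/differentiable_mxP => i j; have [+ _] := cM i j; apply.
  split=> // v; apply/IH => i j; have [_ /(_ v)] := cM i j.
  by apply: eq_Ck => // x Ax; rewrite derive_mxE //; exact: dM.
Qed.

End SmoothCalculus.

(** * Symmetry of second derivatives *)

Lemma dist_le_of_halves (R : realFieldType) (e w z p q : R) : w = z ->
  `|p - w| < e / 2 -> `|q - z| < e / 2 -> `|p - q| <= e.
Proof.
move=> -> pz qz; rewrite -(subrKA z) (le_trans (ler_normD _ _)) //.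
by rewrite (splitr e); apply: lerD; [exact: ltW|rewrite distrC ltW].
Qed.

Section Schwarz.
Context (R : realType) (V : normedModType R).
Implicit Types (A : set V) (x u v : V).

Lemma is_derive_line (W : normedModType R) (f : V -> W) p u (s : R) :
  differentiable f (p + s *: u) ->
  is_derive s 1 (fun s => f (p + s *: u)) ('D_u f (p + s *: u)).
Proof.
move=> /(@diff_derivable _ _ _ _ _ u) df.
have E : (fun h : R => h^-1 *: (((fun s => f (p + s *: u)) \o shift s) (h *: 1)
      - f (p + s *: u))) =
    (fun h => h^-1 *: ((f \o shift (p + s *: u)) (h *: u) - f (p + s *: u))).
  apply/funext => h /=; congr (_ *: (f _ - _)).
  by rewrite scalerDl [h *: 1]mulr1 addrCA.
by apply: DeriveDef; [rewrite /derivable E|rewrite /derive E].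
Qed.

(* Two applications of the mean value theorem; exchanging [u] and [v] leaves
   the left-hand side unchanged, whence the symmetry of second derivatives. *)
Lemma second_difference A (f : V -> R) x u v (h : R) : 0 < h ->
  Ck_on 2 A f ->
  (forall s t, 0 <= s <= h -> 0 <= t <= h -> A (x + s *: u + t *: v)) ->
  exists s t, [/\ 0 <= s <= h, 0 <= t <= h &
    f (x + h *: u + h *: v) - f (x + h *: u) - f (x + h *: v) + f x =
    'D_v ('D_u f) (x + s *: u + t *: v) * h * h].
Proof.
move=> h0 [df Df] box.
have dDf y w : A y -> differentiable ('D_w f) y by have [+ _] := Df w; apply.
have hh : 0 <= h <= h by rewrite lexx ltW.
have h00 : 0 <= (0:R) <= h by rewrite lexx ltW.
have oc (c : R) : c \in `]0, h[ -> 0 <= c <= h.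
  by rewrite in_itv /= => /andP[/ltW -> /ltW ->].
have cc (c : R) : c \in `[0, h] -> 0 <= c <= h by rewrite in_itv.
have box0 s : 0 <= s <= h -> A (x + s *: u).
  by move=> hs; have := box s 0 hs h00; rewrite scale0r addr0.
pose phi s := f (x + h *: v + s *: u) - f (x + s *: u).
pose dphi s := 'D_u f (x + h *: v + s *: u) - 'D_u f (x + s *: u).
have phiD s : 0 <= s <= h -> is_derive s 1 phi (dphi s).
  move=> hs; apply: is_deriveB; apply: is_derive_line; apply: df; last exact: box0.
  by rewrite addrAC; exact: box.
have [||s shs Es] := @MVT R phi dphi 0 h h0.
- by move=> s /oc; exact: phiD.
- apply: derivable_within_continuous => s /cc hs.
  by have [] := phiD s hs.
pose psi t := 'D_u f (x + s *: u + t *: v).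
have psiD t : 0 <= t <= h ->
    is_derive t 1 psi ('D_v ('D_u f) (x + s *: u + t *: v)).
  by move=> ht; apply: is_derive_line; apply: dDf; apply: box => //; exact: oc.
have [||t tht Et] := @MVT R psi (fun t => 'D_v ('D_u f) (x + s *: u + t *: v)) 0 h h0.
- by move=> t /oc; exact: psiD.
- apply: derivable_within_continuous => t /cc ht.
  by have [] := psiD t ht.
exists s, t; split; [exact: oc|exact: oc|].
move: Et Es; rewrite /psi /phi /dphi !scale0r !addr0 !subr0 => <-.
rewrite (addrAC x (s *: u)) (addrAC x (h *: u)) => <-; ring.
Qed.

Lemma derive_comm A (f : V -> R) x u v : open A -> Ck_on 2 A f -> A x ->
  'D_u ('D_v f) x = 'D_v ('D_u f) x.
Proof.
move=> oA f2 Ax; apply/eqP; rewrite -subr_eq0 -normr_le0; apply/ler_addgt0Pl => e e0.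
rewrite addr0.
have cD w z : {for x, continuous ('D_w ('D_z f))}.
  by have [_ /(_ z) [_ /(_ w)]] := f2; apply.
have near_x : \forall y \near x, [/\ A y,
    `|'D_u ('D_v f) x - 'D_u ('D_v f) y| < e / 2 &
    `|'D_v ('D_u f) x - 'D_v ('D_u f) y| < e / 2].
  have e20 : 0 < e / 2 by rewrite divr_gt0.
  have /cvgrPdist_lt/(_ _ e20) H1 := cD u v.
  have /cvgrPdist_lt/(_ _ e20) H2 := cD v u.
  have H0 : \forall y \near x, A y by exact: (open_nbhs_nbhs (conj oA Ax)).
  near=> y; split.
  - exact: (near H0).
  - exact: (near H1).
  - exact: (near H2).
have /nbhs_normP[r /= r0 Hr] := near_x.
(* With [h = r / N] the parallelogram with sides [h *: u] and [h *: v] stays in the ball of radius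
   [r]; the summand 1 gives [N > 0] and makes the inequality strict. *)
pose N := `|u| + `|v| + 1; have N0 : 0 < N by rewrite ltr_wpDl // addr_ge0.
pose h := r / N; have h0 : 0 < h by rewrite divr_gt0.
have box s t : 0 <= s <= h -> 0 <= t <= h -> `|x - (x + s *: u + t *: v)| < r.
  move=> /andP[s0 sh] /andP[t0 th]; rewrite -addrA opprD addNKr normrN.
  apply: le_lt_trans (ler_normD _ _) _; rewrite !normrZ !ger0_norm //.
  have -> : r = h * `|u| + h * `|v| + h by rewrite /h /N; field; rewrite gt_eqF.
  apply: (@le_lt_trans _ _ (h * `|u| + h * `|v|)); last by rewrite ltrDl.
  by apply: lerD; apply: ler_wpM2r.
have boxuv s t (hs : 0 <= s <= h) (ht : 0 <= t <= h) := Hr _ (box s t hs ht).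
have [s [t [hs ht E1]]] : exists s t, [/\ 0 <= s <= h, 0 <= t <= h & 
    f (x + h *: u + h *: v) - f (x + h *: u) - f (x + h *: v) + f x =
    'D_v ('D_u f) (x + s *: u + t *: v) * h * h].
  by apply: second_difference f2 _ => // s t hs ht; have [] := boxuv s t hs ht.
have [t' [s' [ht' hs' E2]]] : exists s t, [/\ 0 <= s <= h, 0 <= t <= h & 
    f (x + h *: v + h *: u) - f (x + h *: v) - f (x + h *: u) + f x =
    'D_u ('D_v f) (x + s *: v + t *: u) * h * h].
  apply: second_difference f2 _ => // t' s' ht' hs'.
  by rewrite addrAC; have [] := boxuv s' t' hs' ht'.
have swap (p p' q m y z w : R) : p = p' -> p - q - m + y = z * h * h ->
    p' - m - q + y = w * h * h -> w = z.
  move=> -> E E'; have hh0 : h * h != 0 by rewrite mulf_neq0 // gt_eqF.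
  by apply: (mulIf hh0); rewrite [LHS]mulrA [RHS]mulrA -E -E'; ring.
have E := swap _ _ _ _ _ _ _ (congr1 f (addrAC x (h *: u) (h *: v))) E1 E2.
have {}E := etrans (congr1 ('D_u ('D_v f)) (addrAC x (s' *: u) (t' *: v))) E.
have [_ _ C1] := boxuv s t hs ht; have [_ C2 _] := boxuv s' t' hs' ht'.
exact: (dist_le_of_halves E C2 C1).
Unshelve. all: by end_near. Qed.

End Schwarz.

(** * Product and chain rules for matrix-valued maps *)

Section MatrixCalculus.
Context (R : realType) (V : normedModType R).
Implicit Types (A B : set V) (x u v : V).

Lemma differentiable_mulmx m n p (M : V -> 'M[R]_(m, n)) (N : V -> 'M[R]_(n, p)) x :
  differentiable M x -> differentiable N x -> differentiable (fun y => M y *m N y) x.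
Proof.
move=> /differentiable_mxP dM /differentiable_mxP dN.
apply/differentiable_mxP => i k.
have -> : (fun y => (M y *m N y) i k) = \sum_j (fun y => M y i j) * (fun y => N y j k).
  by apply/funext => y; rewrite mxE fct_sumE.
by apply: differentiable_sum => j; apply: differentiableM.
Qed.

Lemma derive_mulmx m n p (M : V -> 'M[R]_(m, n)) (N : V -> 'M[R]_(n, p)) x v :
  differentiable M x -> differentiable N x ->
  'D_v (fun y => M y *m N y) x = 'D_v M x *m N x + M x *m 'D_v N x.
Proof.
move=> dM dN; apply/matrixP => i k.
rewrite derive_mxE; last exact: differentiable_mulmx.
have -> : (fun y => (M y *m N y) i k) = \sum_j (fun y => M y i j) * (fun y => N y j k).
  by apply/funext => y; rewrite mxE fct_sumE.
have /differentiable_mxP dM' := dM; have /differentiable_mxP dN' := dN.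
rewrite derive_sum; last by move=> j; apply: derivableM; exact: diff_derivable.
rewrite !mxE -big_split /=; apply: eq_bigr => j _.
rewrite deriveM; [|exact: diff_derivable|exact: diff_derivable].
by rewrite !derive_mxE // addrC; congr (_ + _); rewrite [LHS]mulrC.
Qed.

Lemma differentiable_trmx m n (M : V -> 'M[R]_(m, n)) x :
  differentiable M x -> differentiable (fun y => (M y)^T) x.
Proof.
move=> /differentiable_mxP dM; apply/differentiable_mxP => i j.
by rewrite (_ : (fun y => _) = (fun y => M y j i)) //; apply/funext => y; rewrite mxE.
Qed.

Lemma derive_trmx m n (M : V -> 'M[R]_(m, n)) x v : differentiable M x ->
  'D_v (fun y => (M y)^T) x = ('D_v M x)^T.
Proof.
move=> dM; apply/matrixP => i j; rewrite derive_mxE; last exact: differentiable_trmx.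
rewrite mxE derive_mxE //.
by congr ('D_v _ x); apply/funext => y; rewrite mxE.
Qed.

Lemma differentiable_scalemx m n (f : V -> R) (M : V -> 'M[R]_(m, n)) x :
  differentiable f x -> differentiable M x -> differentiable (fun y => f y *: M y) x.
Proof.
move=> df /differentiable_mxP dM; apply/differentiable_mxP => i j.
rewrite (_ : (fun y => _) = f * (fun y => M y i j)); first exact: differentiableM.
by apply/funext => y; rewrite mxE.
Qed.

Lemma derive_scalemx m n (f : V -> R) (M : V -> 'M[R]_(m, n)) x v :
  differentiable f x -> differentiable M x ->
  'D_v (fun y => f y *: M y) x = 'D_v f x *: M x + f x *: 'D_v M x.
Proof.
move=> df dM; have /differentiable_mxP dM' := dM; apply/matrixP => i j.
rewrite derive_mxE; last exact: differentiable_scalemx.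
rewrite (_ : (fun y => _) = f * (fun y => M y i j)); last first.
  by apply/funext => y; rewrite mxE.
rewrite deriveM; [|exact: diff_derivable|exact: diff_derivable].
by rewrite !mxE derive_mxE // addrC; congr (_ + _); rewrite [LHS]mulrC.
Qed.

Lemma deriveDf (W : normedModType R) (f g : V -> W) x v :
  differentiable f x -> differentiable g x ->
  'D_v (fun y => f y + g y) x = 'D_v f x + 'D_v g x.
Proof. by move=> df dg; rewrite -deriveD //; exact: diff_derivable. Qed.

Lemma deriveBf (W : normedModType R) (f g : V -> W) x v :
  differentiable f x -> differentiable g x ->
  'D_v (fun y => f y - g y) x = 'D_v f x - 'D_v g x.
Proof. by move=> df dg; rewrite -deriveB //; exact: diff_derivable. Qed.

Lemma deriveMf (f g : V -> R) x v :
  differentiable f x -> differentiable g x ->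
  'D_v (fun y => f y * g y) x = 'D_v f x * g x + f x * 'D_v g x.
Proof.
move=> df dg; rewrite [LHS]deriveM; [|exact: diff_derivable|exact: diff_derivable].
by rewrite addrC; congr (_ + _); rewrite [LHS]mulrC.
Qed.

Lemma derive_sumf (W : normedModType R) n (f : 'I_n -> V -> W) x v :
  (forall i, differentiable (f i) x) ->
  'D_v (fun y => \sum_i f i y) x = \sum_i 'D_v (f i) x.
Proof.
move=> df; rewrite -derive_sum; last by move=> i; exact: diff_derivable.
by congr ('D_v _ x); apply/funext => y; rewrite fct_sumE.
Qed.

Lemma deriveDr (W : normedModType R) (f : V -> W) x u v : differentiable f x ->
  'D_(u + v) f x = 'D_u f x + 'D_v f x.
Proof. by move=> df; rewrite !deriveE // linearD. Qed.

Lemma deriveZr (W : normedModType R) (f : V -> W) x (a : R) v : differentiable f x ->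
  'D_(a *: v) f x = a *: 'D_v f x.
Proof. by move=> df; rewrite !deriveE // linearZ. Qed.

Lemma derive_comp (U W : normedModType R) (h : U -> V) (f : V -> W) t (w : U) :
  differentiable h t -> differentiable f (h t) ->
  'D_w (f \o h) t = 'D_('D_w h t) f (h t).
Proof.
move=> dh df; rewrite deriveE; last exact: differentiable_comp.
by rewrite diff_comp //= -!deriveE.
Qed.

End MatrixCalculus.

Section RowCalculus.
Context (R : realType) (n : nat).
Local Notation V := 'rV[R]_n.
Implicit Types (A B : set V) (x u v : V).

(** [Ck_on] differentiates along constant vectors only. Expanding a variable direction in the
    standard basis reduces the chain rule and derivatives along vector fields to that case. *)
Lemma derive_coords (W : normedModType R) (f : V -> W) x v : differentiable f x ->
  'D_v f x = \sum_i v 0 i *: 'D_(delta_mx 0 i) f x.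
Proof.
move=> df; rewrite deriveE // {1}(row_sum_delta v) linear_sum /=.
by apply: eq_bigr => i _; rewrite linearZ /= deriveE.
Qed.

Lemma Ck_comp (U : normedModType R) k (J : set U) B (h : U -> V) (f : V -> R) :
  open J -> open B -> (forall t, J t -> B (h t)) ->
  Ck_on k J h -> Ck_on k B f -> Ck_on k J (f \o h).
Proof.
move=> oJ oB hJ; elim: k h f hJ => [|k IH] h f hJ.
  move=> ch cf t Jt; apply: continuous_comp; first exact: ch.
  by apply: cf; exact: hJ.
move=> hk fk; have hk' := CkS hk.
have dh t (Jt : J t) : differentiable h t by exact: (Ck_differentiable hk Jt).
have df t (Jt : J t) : differentiable f (h t) by exact: (Ck_differentiable fk (hJ t Jt)).
split=> [t Jt|w]; first by apply: differentiable_comp; [exact: dh|exact: df].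
apply: (@eq_Ck _ _ _ _ _ (fun t => \sum_i ('D_w h t) 0 i * ('D_(delta_mx 0 i) f \o h) t)) => //.
  move=> t Jt; rewrite (derive_comp _ (dh t Jt) (df t Jt)).
  by rewrite [RHS](derive_coords _ (df t Jt)).
apply: Ck_sum => // i; apply: CkM => //.
  by have [_ /(_ w) /(Ck_mxP _ _ oJ) ] := hk; apply.
by apply: IH => //; have [_ ] := fk; apply.
Qed.

End RowCalculus.

(** * Stability of smooth maps under the operations of tensor calculus *)

Section SmoothClosure.
Context (R : realType) (V : normedModType R) (A : set V).
Hypothesis oA : open A.

Lemma smooth_differentiable (W : normedModType R) (f : V -> W) x :
  smooth_on A f -> A x -> differentiable f x.
Proof. by move=> sf; have := sf 1%N; exact: Ck_differentiable. Qed.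

Lemma eq_smooth (W : normedModType R) (f g : V -> W) :
  (forall x, A x -> f x = g x) -> smooth_on A f -> smooth_on A g.
Proof. by move=> fg sf k; apply: eq_Ck fg (sf k). Qed.

Lemma smooth_cst (W : normedModType R) (a : W) : smooth_on A (cst a).
Proof. by move=> k; exact: Ck_cst. Qed.

Lemma smooth_derive (W : normedModType R) (f : V -> W) v :
  smooth_on A f -> smooth_on A ('D_v f).
Proof. by move=> sf k; have [_] := sf k.+1; apply. Qed.

Lemma smoothD (W : normedModType R) (f g : V -> W) :
  smooth_on A f -> smooth_on A g -> smooth_on A (fun x => f x + g x).
Proof. by move=> sf sg k; apply: CkD. Qed.

Lemma smoothN (W : normedModType R) (f : V -> W) :
  smooth_on A f -> smooth_on A (fun x => - f x).
Proof.
move=> sf; apply: (@eq_smooth _ (fun x => -1 *: f x)); first by move=> x _; rewrite scaleN1r.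
by move=> k; apply: CkZ.
Qed.

Lemma smoothB (W : normedModType R) (f g : V -> W) :
  smooth_on A f -> smooth_on A g -> smooth_on A (fun x => f x - g x).
Proof. by move=> sf sg; apply: smoothD => //; exact: smoothN. Qed.

Lemma smoothM (f g : V -> R) :
  smooth_on A f -> smooth_on A g -> smooth_on A (fun x => f x * g x).
Proof. by move=> sf sg k; apply: CkM. Qed.

Lemma smoothV (f : V -> R) : (forall x, A x -> f x != 0) ->
  smooth_on A f -> smooth_on A (fun x => (f x)^-1).
Proof. by move=> f0 sf k; apply: CkV. Qed.

Lemma smooth_sum (W : normedModType R) n (f : 'I_n -> V -> W) :
  (forall i, smooth_on A (f i)) -> smooth_on A (fun x => \sum_i f i x).
Proof. by move=> sf k; apply: Ck_sum => // i; exact: sf. Qed.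

Lemma smooth_mxP m n (M : V -> 'M[R]_(m, n)) :
  smooth_on A M <-> forall i j, smooth_on A (fun y => M y i j).
Proof.
split=> [sM i j k|sM k]; first by have /(Ck_mxP _ _ oA) := sM k; apply.
by apply/Ck_mxP => // i j; exact: sM.
Qed.

Lemma smooth_entry m n (M : V -> 'M[R]_(m, n)) i j :
  smooth_on A M -> smooth_on A (fun y => M y i j).
Proof. by move/smooth_mxP; apply. Qed.

Lemma smooth_scalemx m n (f : V -> R) (M : V -> 'M[R]_(m, n)) :
  smooth_on A f -> smooth_on A M -> smooth_on A (fun y => f y *: M y).
Proof.
move=> sf sM; apply/smooth_mxP => i j.
apply: (@eq_smooth _ (fun y => f y * M y i j)); first by move=> x _; rewrite mxE.
by apply: smoothM => //; exact: smooth_entry.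
Qed.

Lemma smooth_mulmx m n p (M : V -> 'M[R]_(m, n)) (N : V -> 'M[R]_(n, p)) :
  smooth_on A M -> smooth_on A N -> smooth_on A (fun y => M y *m N y).
Proof.
move=> sM sN; apply/smooth_mxP => i k.
apply: (@eq_smooth _ (fun y => \sum_j M y i j * N y j k)); first by move=> x _; rewrite mxE.
by apply: smooth_sum => j; apply: smoothM; exact: smooth_entry.
Qed.

Lemma smooth_trmx m n (M : V -> 'M[R]_(m, n)) :
  smooth_on A M -> smooth_on A (fun y => (M y)^T).
Proof.
move=> sM; apply/smooth_mxP => i j.
apply: (@eq_smooth _ (fun y => M y j i)); first by move=> x _; rewrite mxE.
exact: smooth_entry.
Qed.

Lemma smooth_det n (M : V -> 'M[R]_n) :
  smooth_on A M -> smooth_on A (fun y => \det (M y)).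
Proof.
elim: n M => [|n IH] M sM.
  by apply: (@eq_smooth _ (cst (1 : R))); [move=> x _; rewrite det_mx00|exact: smooth_cst].
apply: (@eq_smooth _ (fun y => \sum_j M y ord0 j *
    ((-1) ^+ ((ord0 : 'I_n.+1) + j) * \det (row' ord0 (col' j (M y)))))).
  by move=> x _; rewrite (expand_det_row _ ord0).
apply: smooth_sum => j; apply: smoothM; first exact: smooth_entry.
apply: smoothM; first exact: smooth_cst.
apply: IH; apply/smooth_mxP => k l.
apply: (@eq_smooth _ (fun y => M y (lift ord0 k) (lift j l))); first by move=> x _; rewrite !mxE.
exact: smooth_entry.
Qed.

(** Cramer's rule. It is what makes [ricci_op], and with it the scalar curvature, smooth. *)
Lemma smooth_invmx n (M : V -> 'M[R]_n) : (forall x, A x -> M x \in unitmx) ->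
  smooth_on A M -> smooth_on A (fun y => invmx (M y)).
Proof.
move=> uM sM; apply: (@eq_smooth _ (fun y => (\det (M y))^-1 *: \adj (M y))).
  by move=> x Ax; rewrite /invmx uM.
apply: smooth_scalemx.
  by apply: smoothV; [move=> x /uM; rewrite unitmxE unitfE|exact: smooth_det].
apply/smooth_mxP => i j.
case: n M {uM} sM i j => [|n] M sM i j; first by case: i.
apply: (@eq_smooth _ (fun y => (-1) ^+ (j + i) * \det (row' j (col' i (M y))))).
  by move=> x _; rewrite mxE.
apply: smoothM; first exact: smooth_cst.
apply: smooth_det; apply/smooth_mxP => k l.
apply: (@eq_smooth _ (fun y => M y (lift j k) (lift i l))); first by move=> x _; rewrite !mxE.
exact: smooth_entry.
Qed.

Lemma smooth_bil n (g : V -> 'M[R]_n) (X Y : V -> 'rV[R]_n) :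
  smooth_on A g -> smooth_on A X -> smooth_on A Y ->
  smooth_on A (fun x => bil (g x) (X x) (Y x)).
Proof.
move=> sg sX sY; apply: (@smooth_entry 1 1 (fun x => X x *m g x *m (Y x)^T)).
by apply: smooth_mulmx; [exact: smooth_mulmx|exact: smooth_trmx].
Qed.

Lemma smooth_gamma n (G : V -> 'I_n -> 'I_n -> 'rV[R]_n) (X Y : V -> 'rV[R]_n) :
  (forall i j, smooth_on A (fun x => G x i j)) -> smooth_on A X -> smooth_on A Y ->
  smooth_on A (fun x => gamma_at (G x) (X x) (Y x)).
Proof.
move=> sG sX sY; apply: smooth_sum => i; apply: smooth_sum => j.
by apply: smooth_scalemx => //; apply: smoothM; exact: smooth_entry.
Qed.

End SmoothClosure.

Lemma smooth_derive_field (R : realType) n (A : set 'rV[R]_n) m p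
    (X : 'rV[R]_n -> 'rV[R]_n) (f : 'rV[R]_n -> 'M[R]_(m, p)) : open A ->
  smooth_on A X -> smooth_on A f -> smooth_on A (fun x => 'D_(X x) f x).
Proof.
move=> oA sX sf.
apply: (@eq_smooth _ _ _ oA _ (fun x => \sum_i X x 0 i *: 'D_(delta_mx 0 i) f x)).
  by move=> x Ax; rewrite -derive_coords //; exact: smooth_differentiable sf Ax.
apply: smooth_sum => // i; apply: smooth_scalemx => //; first exact: smooth_entry.
exact: smooth_derive.
Qed.

(** * Covariant derivative and curvature in a chart *)

Section GammaBilinear.
Context (R : realType) (n : nat) (G : 'I_n -> 'I_n -> 'rV[R]_n).
Implicit Types u v w : 'rV[R]_n.

Lemma gammaDl u v w : gamma_at G (u + v) w = gamma_at G u w + gamma_at G v w.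
Proof.
rewrite /gamma_at -big_split; apply: eq_bigr => i _ /=.
by rewrite -big_split; apply: eq_bigr => j _ /=; rewrite mxE mulrDl scalerDl.
Qed.

Lemma gammaZl a u v : gamma_at G (a *: u) v = a *: gamma_at G u v.
Proof.
rewrite /gamma_at scaler_sumr; apply: eq_bigr => i _ /=.
by rewrite scaler_sumr; apply: eq_bigr => j _ /=; rewrite mxE -mulrA scalerA.
Qed.

Lemma gammaDr u v w : gamma_at G u (v + w) = gamma_at G u v + gamma_at G u w.
Proof.
rewrite /gamma_at -big_split; apply: eq_bigr => i _ /=.
by rewrite -big_split; apply: eq_bigr => j _ /=; rewrite mxE mulrDr scalerDl.
Qed.

Lemma gammaZr a u v : gamma_at G u (a *: v) = a *: gamma_at G u v.
Proof.
rewrite /gamma_at scaler_sumr; apply: eq_bigr => i _ /=.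
by rewrite scaler_sumr; apply: eq_bigr => j _ /=; rewrite mxE mulrCA scalerA.
Qed.

Lemma gammaNr u v : gamma_at G u (- v) = - gamma_at G u v.
Proof. by rewrite -scaleN1r gammaZr scaleN1r. Qed.

Lemma gamma0l v : gamma_at G 0 v = 0.
Proof. by have := gammaZl 0 0 v; rewrite !scale0r. Qed.

Lemma gamma0r v : gamma_at G v 0 = 0.
Proof. by have := gammaZr 0 v 0; rewrite !scale0r. Qed.

Lemma gamma_sumr m (F : 'I_m -> 'rV[R]_n) v :
  gamma_at G v (\sum_i F i) = \sum_i gamma_at G v (F i).
Proof. exact: (big_morph (gamma_at G v) (gammaDr v) (gamma0r v)). Qed.

Lemma gamma_suml m (F : 'I_m -> 'rV[R]_n) v :
  gamma_at G (\sum_i F i) v = \sum_i gamma_at G (F i) v.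
Proof.
exact: (big_morph (fun u => gamma_at G u v) (fun u w => gammaDl u w v) (gamma0l v)).
Qed.

End GammaBilinear.

Section Covariant.
Context (R : realType) (n : nat).
Local Notation V := 'rV[R]_n.
Variables (A : set V) (G : V -> 'I_n -> 'I_n -> V).
Hypothesis oA : open A.
Hypothesis sG : forall i j, smooth_on A (fun x => G x i j).
Implicit Types (X Y Z W : V -> V) (x u v w : V).
Local Notation e i := (delta_mx 0 i : V).
Local Notation cov := (cov G).
Local Notation curv := (curv G).

Lemma smooth_cov X Y : smooth_on A X -> smooth_on A Y -> smooth_on A (cov X Y).
Proof.
move=> sX sY; apply: smoothD => //; first exact: smooth_derive_field.
exact: smooth_gamma.
Qed.

Lemma eq_cov X X' Y Y' x : A x -> X x = X' x -> (forall y, A y -> Y y = Y' y) ->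
  cov X Y x = cov X' Y' x.
Proof.
move=> Ax EX EY; rewrite /Defs.cov EX (EY x Ax); congr (_ + _).
exact: eq_on_derive EY Ax.
Qed.

Lemma covD X Y Z x : differentiable Y x -> differentiable Z x ->
  cov X (fun y => Y y + Z y) x = cov X Y x + cov X Z x.
Proof. by move=> dY dZ; rewrite /Defs.cov deriveDf // gammaDr addrACA. Qed.

Lemma covB X Y Z x : differentiable Y x -> differentiable Z x ->
  cov X (fun y => Y y - Z y) x = cov X Y x - cov X Z x.
Proof.
by move=> dY dZ; rewrite /Defs.cov deriveBf // gammaDr gammaNr opprD addrACA.
Qed.

Lemma cov_scale X (f : V -> R) Y x : differentiable f x -> differentiable Y x ->
  cov X (fun y => f y *: Y y) x = 'D_(X x) f x *: Y x + f x *: cov X Y x.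
Proof. by move=> df dY; rewrite /Defs.cov derive_scalemx // gammaZr scalerDr addrA. Qed.

Lemma cov_sum X m (Y : 'I_m -> V -> V) x : (forall i, differentiable (Y i) x) ->
  cov X (fun y => \sum_i Y i y) x = \sum_i cov X (Y i) x.
Proof. by move=> dY; rewrite /Defs.cov derive_sumf // gamma_sumr -big_split. Qed.

Lemma cov_coords X Y x : differentiable Y x ->
  cov X Y x = \sum_i X x 0 i *: cov (cst (e i)) Y x.
Proof.
move=> dY; rewrite /Defs.cov derive_coords // {2}(row_sum_delta (X x)) gamma_suml.
by rewrite -big_split; apply: eq_bigr => i _; rewrite gammaZl scalerDr.
Qed.

Lemma smooth_cov_cst u Y : smooth_on A Y -> smooth_on A (cov (cst u) Y).
Proof. by move=> sY; apply: smooth_cov => //; exact: smooth_cst. Qed.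

(** The first sum, which differentiates the components of [Y], is the part that the bracket term of
    the curvature cancels; the second depends on [X] and [Y] only through their values at [x]. *)
Lemma cov_cov X Y Z x : smooth_on A Y -> smooth_on A Z -> A x ->
  cov X (cov Y Z) x =
  \sum_j 'D_(X x) (fun y => Y y 0 j) x *: cov (cst (e j)) Z x +
  \sum_j \sum_i (X x 0 i * Y x 0 j) *: cov (cst (e i)) (cov (cst (e j)) Z) x.
Proof.
move=> sY sZ Ax.
rewrite (@eq_cov X X _ (fun y => \sum_j Y y 0 j *: cov (cst (e j)) Z y)) //; last first.
  by move=> y Ay; apply: cov_coords; exact: smooth_differentiable sZ Ay.
have dYj j : differentiable (fun y => Y y 0 j) x.
  by apply: (smooth_differentiable _ Ax); exact: smooth_entry.
have dcZ j : differentiable (cov (cst (e j)) Z) x.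
  by apply: (smooth_differentiable _ Ax); exact: smooth_cov_cst.
rewrite cov_sum; last by move=> j; exact: differentiable_scalemx.
rewrite -big_split; apply: eq_bigr => j _ /=.
rewrite cov_scale //; congr (_ + _).
rewrite (cov_coords X) // scaler_sumr; apply: eq_bigr => i _.
by rewrite scalerA mulrC.
Qed.

Lemma curv_coords X Y Z x : smooth_on A X -> smooth_on A Y -> smooth_on A Z -> A x ->
  curv X Y Z x = \sum_i \sum_j (X x 0 i * Y x 0 j) *:
    (cov (cst (e i)) (cov (cst (e j)) Z) x - cov (cst (e j)) (cov (cst (e i)) Z) x).
Proof.
move=> sX sY sZ Ax.
have dX := smooth_differentiable sX Ax; have dY := smooth_differentiable sY Ax.
have EB : cov (bracket X Y) Z x =
    \sum_j 'D_(X x) (fun y => Y y 0 j) x *: cov (cst (e j)) Z x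
    - \sum_j 'D_(Y x) (fun y => X y 0 j) x *: cov (cst (e j)) Z x.
  rewrite cov_coords; last exact: smooth_differentiable sZ Ax.
  rewrite -sumrB; apply: eq_bigr => j _.
  by rewrite /bracket mxE [X in _ + X]mxE !derive_mxE // scalerBl.
rewrite /Defs.curv !cov_cov // EB.
have abel (s1 t1 s2 t2 : V) : s1 + t1 - (s2 + t2) - (s1 - s2) = t1 - t2.
  by apply/matrixP => i j; rewrite !mxE; ring.
rewrite abel exchange_big -sumrB; apply: eq_bigr => i _ /=.
rewrite -sumrB; apply: eq_bigr => j _ /=.
by rewrite scalerBr (mulrC (Y x 0 j)) .
Qed.

Lemma curv_cst u v Z x : A x -> smooth_on A Z ->
  curv (cst u) (cst v) Z x =
  cov (cst u) (cov (cst v) Z) x - cov (cst v) (cov (cst u) Z) x.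
Proof.
move=> Ax sZ; rewrite /Defs.curv (_ : cov (bracket _ _) Z x = 0) ?subr0 //.
by rewrite /Defs.cov /bracket !derive_cst subr0 gamma0l derive0 add0r.
Qed.

(** Tensoriality in the third argument: the second derivatives of the components of [Z] cancel by
    [derive_comm], and the terms with one derivative of a component are symmetric in [i] and [j]. *)
Lemma curv_field i j Z x : smooth_on A Z -> A x ->
  curv (cst (e i)) (cst (e j)) Z x =
  \sum_k Z x 0 k *: curv_at G x (e i) (e j) (e k).
Proof.
move=> sZ Ax.
have sZk k : smooth_on A (fun y => Z y 0 k) by exact: smooth_entry.
have dZk k y : A y -> differentiable (fun y => Z y 0 k) y.
  exact: smooth_differentiable.
have dDZk k y l : A y -> differentiable ('D_(e l) (fun y => Z y 0 k)) y.
  by apply: smooth_differentiable; exact: smooth_derive.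
have sce l k : smooth_on A (cov (cst (e l)) (cst (e k))).
  by apply: smooth_cov_cst; exact: smooth_cst.
have dce l k y : A y -> differentiable (cov (cst (e l)) (cst (e k))) y.
  exact: smooth_differentiable.
have covZ l y : A y -> cov (cst (e l)) Z y =
    \sum_k ('D_(e l) (fun y => Z y 0 k) y *: e k + Z y 0 k *: cov (cst (e l)) (cst (e k)) y).
  move=> Ay; rewrite (@eq_cov _ (cst (e l)) _ (fun y => \sum_k Z y 0 k *: cst (e k) y)) //; last first.
    by move=> z _; rewrite {1}(row_sum_delta (Z z)).
  rewrite cov_sum; last by move=> k; apply: differentiable_scalemx; [exact: dZk|exact: differentiable_cst].
  apply: eq_bigr => k _; rewrite cov_scale //; first exact: dZk.
have cov2 l m : cov (cst (e l)) (cov (cst (e m)) Z) x =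
    \sum_k ('D_(e l) ('D_(e m) (fun y => Z y 0 k)) x *: e k
      + 'D_(e m) (fun y => Z y 0 k) x *: cov (cst (e l)) (cst (e k)) x
      + ('D_(e l) (fun y => Z y 0 k) x *: cov (cst (e m)) (cst (e k)) x
      + Z x 0 k *: cov (cst (e l)) (cov (cst (e m)) (cst (e k))) x)).
  rewrite (@eq_cov _ (cst (e l)) _ _ _ Ax _ (covZ m)) //.
  have d1 k : differentiable (fun y => 'D_(e m) (fun y => Z y 0 k) y *: cst (e k) y) x.
    by apply: differentiable_scalemx; [exact: dDZk|exact: differentiable_cst].
  have d2 k : differentiable (fun y => Z y 0 k *: cov (cst (e m)) (cst (e k)) y) x.
    by apply: differentiable_scalemx; [exact: dZk|exact: dce].
  rewrite (cov_sum _ (Y := fun k y => 'D_(e m) (fun y => Z y 0 k) y *: e k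
    + Z y 0 k *: cov (cst (e m)) (cst (e k)) y)); last by move=> k; exact: differentiableD (d1 k) (d2 k).
  apply: eq_bigr => k _; rewrite covD //.
  rewrite (@cov_scale _ ('D_(e m) (fun y => Z y 0 k)) (cst (e k))) //; last exact: dDZk.
  by rewrite cov_scale; [|exact: dZk|exact: dce].
rewrite curv_cst // (cov2 i j) (cov2 j i) -sumrB; apply: eq_bigr => k _.
rewrite /curv_at curv_cst //; last exact: smooth_cst.
rewrite (@derive_comm _ _ A (fun y => Z y 0 k) x (e i)) //; last exact: sZk.
do 4 move: (cov (cst _) _ x) => ?; move: (e k) ('D_(e j) _ x) ('D_(e i) _ x) ('D_(e j) _ x) => p ? ? ?.
by apply/rowP => q; rewrite !mxE; ring.
Qed.

Lemma curvE X Y Z x : smooth_on A X -> smooth_on A Y -> smooth_on A Z -> A x ->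
  curv X Y Z x = \sum_i \sum_j \sum_k
    (X x 0 i * Y x 0 j * Z x 0 k) *: curv_at G x (e i) (e j) (e k).
Proof.
move=> sX sY sZ Ax; rewrite curv_coords //; apply: eq_bigr => i _; apply: eq_bigr => j _.
rewrite -curv_cst // curv_field // scaler_sumr; apply: eq_bigr => k _.
by rewrite scalerA.
Qed.

Lemma curv_atE x u v w : A x -> curv_at G x u v w =
  \sum_i \sum_j \sum_k (u 0 i * v 0 j * w 0 k) *: curv_at G x (e i) (e j) (e k).
Proof. by move=> Ax; rewrite /curv_at curvE //; exact: smooth_cst. Qed.

Lemma curv_tensor X Y Z x : smooth_on A X -> smooth_on A Y -> smooth_on A Z -> A x ->
  curv X Y Z x = curv_at G x (X x) (Y x) (Z x).
Proof. by move=> sX sY sZ Ax; rewrite curvE // curv_atE. Qed.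

Lemma smooth_bracket X Y : smooth_on A X -> smooth_on A Y -> smooth_on A (bracket X Y).
Proof. by move=> sX sY; apply: smoothB => //; exact: smooth_derive_field. Qed.

Lemma smooth_curv X Y Z : smooth_on A X -> smooth_on A Y -> smooth_on A Z ->
  smooth_on A (curv X Y Z).
Proof.
move=> sX sY sZ; apply: smoothB => //; first by apply: smoothB => //; do 2 apply: smooth_cov => //.
by apply: smooth_cov => //; exact: smooth_bracket.
Qed.

Lemma smooth_ricci : smooth_on A (ricci G).
Proof.
apply/smooth_mxP => // i j.
apply: (@eq_smooth _ _ _ oA _ (fun x => \sum_k curv (cst (e k)) (cst (e i)) (cst (e j)) x 0 k)).
  by move=> x _; rewrite mxE.
apply: smooth_sum => // k; apply: smooth_entry => //.
by apply: smooth_curv; exact: smooth_cst.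
Qed.

End Covariant.

Section BilinearForms.
Context (R : realType) (n : nat).
Implicit Types (g : 'M[R]_n) (u v w : 'rV[R]_n) (a : R).

Lemma bilDl g u v w : bil g (u + v) w = bil g u w + bil g v w.
Proof. by rewrite /bil !mulmxDl mxE. Qed.
Lemma bilZl g a u v : bil g (a *: u) v = a * bil g u v.
Proof. by rewrite /bil -!scalemxAl mxE. Qed.
Lemma bilDr g u v w : bil g u (v + w) = bil g u v + bil g u w.
Proof. by rewrite /bil linearD /= mulmxDr mxE. Qed.
Lemma bilZr g a u v : bil g u (a *: v) = a * bil g u v.
Proof. by rewrite /bil linearZ /= -scalemxAr mxE. Qed.
Lemma bilNl g u v : bil g (- u) v = - bil g u v.
Proof. by rewrite -scaleN1r bilZl mulN1r. Qed.
Lemma bilNr g u v : bil g u (- v) = - bil g u v.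
Proof. by rewrite -scaleN1r bilZr mulN1r. Qed.
Lemma bil0l g v : bil g 0 v = 0.
Proof. by rewrite -(scale0r 0) bilZl mul0r. Qed.
Lemma bil0r g v : bil g v 0 = 0.
Proof. by rewrite -(scale0r 0) bilZr mul0r. Qed.
Lemma bil_sum g m (F : 'I_m -> 'rV[R]_n) v :
  bil g (\sum_i F i) v = \sum_i bil g (F i) v.
Proof. exact: (big_morph (fun u => bil g u v) (fun u w => bilDl g u w v) (bil0l g v)). Qed.

Lemma bilC g u v : g^T = g -> bil g u v = bil g v u.
Proof.
move=> sg; have {1}-> : bil g u v = (u *m g *m v^T)^T 0 0 by rewrite mxE.
by rewrite !trmx_mul trmxK sg mulmxA.
Qed.

Lemma bil_nondeg g u : g \in unitmx -> (forall v, bil g u v = 0) -> u = 0.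
Proof.
move=> ug h; apply: (can_inj (mulmxK ug)); rewrite mul0mx; apply/rowP => j.
by have := h (delta_mx 0 j); rewrite /bil trmx_delta -colE [X in X = _]mxE => ->; rewrite mxE.
Qed.

Lemma bil_inj g u v : g \in unitmx -> (forall w, bil g u w = bil g v w) -> u = v.
Proof.
move=> ug h; apply/eqP; rewrite -subr_eq0; apply/eqP; apply: bil_nondeg ug _ => w.
by rewrite bilDl bilNl h subrr.
Qed.

Lemma bil_delta g i j : bil g (delta_mx 0 i) (delta_mx 0 j) = g i j.
Proof. by rewrite /bil -rowE trmx_delta -colE mxE mxE. Qed.

Lemma lorentz_unit g : lorentz_signature g -> g \in unitmx.
Proof.
move=> [P uP E]; have : \det (P *m g *m P^T) != 0.
  rewrite E det_diag; apply/prodf_neq0 => i _; rewrite mxE; case: ifP => _;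
  by rewrite ?oppr_eq0 oner_eq0.
by rewrite !det_mulmx !mulf_eq0 !negb_or unitmxE unitfE => /andP[/andP[]].
Qed.

End BilinearForms.

Section CurvMultilinear.
Context (R : realType) (n : nat).
Local Notation V := 'rV[R]_n.
Variables (A : set V) (G : V -> 'I_n -> 'I_n -> V) (x : V).
Hypothesis oA : open A.
Hypothesis sG : forall i j, smooth_on A (fun x => G x i j).
Hypothesis Ax : A x.
Implicit Types u v w : V.

Lemma curvDl u u' v w :
  curv_at G x (u + u') v w = curv_at G x u v w + curv_at G x u' v w.
Proof.
rewrite !(curv_atE oA sG _ _ _ Ax) -!big_split; apply: eq_bigr => i _ /=.
rewrite -!big_split; apply: eq_bigr => j _ /=.
rewrite -!big_split; apply: eq_bigr => k _ /=.
by rewrite mxE !mulrDl scalerDl.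
Qed.

Lemma curvDm u v v' w :
  curv_at G x u (v + v') w = curv_at G x u v w + curv_at G x u v' w.
Proof.
rewrite !(curv_atE oA sG _ _ _ Ax) -!big_split; apply: eq_bigr => i _ /=.
rewrite -!big_split; apply: eq_bigr => j _ /=.
rewrite -!big_split; apply: eq_bigr => k _ /=.
by rewrite mxE mulrDr !mulrDl scalerDl.
Qed.

Lemma curvDr u v w w' :
  curv_at G x u v (w + w') = curv_at G x u v w + curv_at G x u v w'.
Proof.
rewrite !(curv_atE oA sG _ _ _ Ax) -!big_split; apply: eq_bigr => i _ /=.
rewrite -!big_split; apply: eq_bigr => j _ /=.
rewrite -!big_split; apply: eq_bigr => k _ /=.
by rewrite mxE mulrDr scalerDl.
Qed.

Lemma curvZl a u v w : curv_at G x (a *: u) v w = a *: curv_at G x u v w.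
Proof.
rewrite !(curv_atE oA sG _ _ _ Ax) scaler_sumr; apply: eq_bigr => i _ /=.
rewrite scaler_sumr; apply: eq_bigr => j _ /=.
rewrite scaler_sumr; apply: eq_bigr => k _ /=.
by rewrite mxE scalerA !mulrA.
Qed.

Lemma curvZm a u v w : curv_at G x u (a *: v) w = a *: curv_at G x u v w.
Proof.
rewrite !(curv_atE oA sG _ _ _ Ax) scaler_sumr; apply: eq_bigr => i _ /=.
rewrite scaler_sumr; apply: eq_bigr => j _ /=.
rewrite scaler_sumr; apply: eq_bigr => k _ /=.
by rewrite mxE scalerA; congr (_ *: _); ring.
Qed.

Lemma curvZr a u v w : curv_at G x u v (a *: w) = a *: curv_at G x u v w.
Proof.
rewrite !(curv_atE oA sG _ _ _ Ax) scaler_sumr; apply: eq_bigr => i _ /=.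
rewrite scaler_sumr; apply: eq_bigr => j _ /=.
rewrite scaler_sumr; apply: eq_bigr => k _ /=.
by rewrite mxE scalerA; congr (_ *: _); ring.
Qed.

End CurvMultilinear.

Section LeviCivita.
Context (R : realType) (n : nat).
Local Notation V := 'rV[R]_n.
Variables (A : set V) (G : V -> 'I_n -> 'I_n -> V) (g : V -> 'M[R]_n).
Hypothesis oA : open A.
Hypothesis LC : levi_civita_on G g A.
Hypothesis sg : smooth_on A g.
Hypothesis symg : forall x, A x -> (g x)^T = g x.
Implicit Types (X Y Z : V -> V) (x u v w z : V).

Lemma lc_smooth i j : smooth_on A (fun x => G x i j).
Proof. by case: LC. Qed.
Let sG := lc_smooth.

(** Both sides depend on [X] only through [X x], so [X] may be frozen to a constant field and need
    not be smooth. *)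
Lemma lc_derive X Y Z x : smooth_on A Y -> smooth_on A Z -> A x ->
  'D_(X x) (fun y => bil (g y) (Y y) (Z y)) x =
  bil (g x) (cov G X Y x) (Z x) + bil (g x) (Y x) (cov G X Z x).
Proof.
case: LC => _ _ H sY sZ Ax; exact: (H (cst (X x)) Y Z (smooth_cst _ _) sY sZ x Ax).
Qed.

Lemma cov_cst u v x : cov G (cst u) (cst v) x = gamma_at (G x) u v.
Proof. by rewrite /cov derive_cst add0r. Qed.

Lemma gamma_sym u v x : A x -> gamma_at (G x) u v = gamma_at (G x) v u.
Proof.
case: LC => _ H _ Ax; rewrite -!cov_cst; apply/eqP; rewrite -subr_eq0.
rewrite (H _ _ (smooth_cst _ _) (smooth_cst _ _) x Ax).
by rewrite /bracket !derive_cst subrr.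
Qed.

Lemma curv_atC u v w x : A x -> curv_at G x u v w = - curv_at G x v u w.
Proof.
move=> Ax; rewrite /curv_at !(curv_cst (A := A)) ?opprB //; exact: smooth_cst.
Qed.

(** The second derivatives of [g(w, w)] commute. Expanded by metric compatibility, their difference
    is twice the left-hand side, the products of first covariant derivatives being symmetric in [u]
    and [v]. *)
Lemma curv_skew u v w x : A x -> bil (g x) (curv_at G x u v w) w = 0.
Proof.
move=> Ax; pose F y := bil (g y) w w.
have sF : smooth_on A F by apply: smooth_bil => //; exact: smooth_cst.
have sc u' : smooth_on A (cov G (cst u') (cst w)).
  by apply: smooth_cov_cst => //; exact: smooth_cst.
have DF u' y : A y -> 'D_u' F y = 2 * bil (g y) (cov G (cst u') (cst w) y) (cst w y).
  move=> Ay; have := @lc_derive (cst u') (cst w) (cst w) y (smooth_cst _ _) (smooth_cst _ _) Ay.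
  by rewrite /F /= => ->; rewrite (bilC _ (cst w y)) ?symg //; ring.
have DDF u' v' : 'D_u' ('D_v' F) x = 2 * (bil (g x) (cov G (cst u') (cov G (cst v') (cst w)) x) w
    + bil (g x) (cov G (cst v') (cst w) x) (cov G (cst u') (cst w) x)).
  rewrite (eq_on_derive _ oA (DF v') Ax).
  have dB : differentiable (fun y => bil (g y) (cov G (cst v') (cst w) y) (cst w y)) x.
    by apply: (smooth_differentiable _ Ax); apply: smooth_bil => //; exact: smooth_cst.
  rewrite (deriveMf _ (differentiable_cst _ _) dB) derive_cst mul0r add0r.
  by rewrite (@lc_derive (cst u')) //; exact: smooth_cst.
have := derive_comm u v oA (sF 2) Ax.
rewrite /curv_at (curv_cst G u v Ax (smooth_cst A w)).
rewrite (DDF u v) (DDF v u) (bilC _ (cov G (cst u) (cst w) x)) ?symg //.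
move: (cov G _ (cov _ _ _) x) (cov G _ (cov _ _ _) x) => p q.
rewrite bilDl bilNl => E; lra.
Qed.

Lemma curv_skew2 u v w z x : A x ->
  bil (g x) (curv_at G x u v w) z = - bil (g x) (curv_at G x u v z) w.
Proof.
move=> Ax; have := curv_skew u v (w + z) Ax.
rewrite (curvDr oA sG Ax) bilDl !bilDr !curv_skew // add0r addr0 => /eqP.
by rewrite addr_eq0 => /eqP.
Qed.

Lemma bianchi1 u v w x : A x ->
  curv_at G x u v w + curv_at G x v w u + curv_at G x w u v = 0.
Proof.
move=> Ax; rewrite /curv_at !(curv_cst (A := A)) //; try exact: smooth_cst.
have E p q r : cov G (cst p) (cov G (cst q) (cst r)) x = cov G (cst p) (cov G (cst r) (cst q)) x.
  by apply: (@eq_cov R n A G oA) => // y Ay; rewrite !cov_cst gamma_sym.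
rewrite (E u w v) (E v u w) (E w v u); do 3 move: (cov G _ (cov _ _ _) x) => ?.
by apply/matrixP => i j; rewrite !mxE; ring.
Qed.

Lemma curv_pair u v w z x : A x ->
  bil (g x) (curv_at G x u v w) z = bil (g x) (curv_at G x w z u) v.
Proof.
move=> Ax; pose r u v w z := bil (g x) (curv_at G x u v w) z.
have C u' v' w' z' : r u' v' w' z' = - r v' u' w' z' by rewrite /r curv_atC // bilNl.
have S u' v' w' z' : r u' v' w' z' = - r u' v' z' w' by rewrite /r curv_skew2.
have B u' v' w' z' : r u' v' w' z' + r v' w' u' z' + r w' u' v' z' = 0.
  by rewrite /r -!bilDl bianchi1 // bil0l.
rewrite -!/(r _ _ _ _).
(* The classical octahedron argument: four cyclic identities, combined with the skew symmetries,
   form a linear system that contains the claim. *)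
move: (B u v w z) (B v w z u) (B w z u v) (B z u v w).
move: (S v w z u) (S u v z w) (S w z v u) (S z u w v) (C u w z v) (S w u z v) (C v z u w) (S z v u w).
move: (r _ _ _ _) (r _ _ _ _) (r _ _ _ _) (r _ _ _ _) (r _ _ _ _) (r _ _ _ _) (r _ _ _ _)
 (r _ _ _ _) (r _ _ _ _) (r _ _ _ _) (r _ _ _ _) (r _ _ _ _) (r _ _ _ _) (r _ _ _ _) => *.
lra.
Qed.

End LeviCivita.

(** * LP-Sasakian identities *)

Section LPSasakianChart.
Context (R : realType) (n : nat) (M : smooth_manifold R n) (L : lp_sasakian M) (c : atlas M).
Local Notation V := 'rV[R]_n.
Local Notation A := (cimg (mchart c)).
Local Notation G := (lp_nabla L c).
Local Notation g := (lp_g L c).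
Local Notation phi := (lp_phi L c).
Local Notation xi := (lp_xi L c).
Local Notation eta := (lp_eta L c).
Implicit Types (X Y Z : V -> V) (x u v w z : V).

Lemma open_cimg : open A.
Proof. exact: cimg_open. Qed.
Let oA := open_cimg.

Lemma smooth_g : smooth_on A g.
Proof. by have [[+ _] _] := lp_g_metric L; apply. Qed.

Lemma g_sym x : A x -> (g x)^T = g x.
Proof. by move=> Ax; have [_ /(_ c x Ax) []] := lp_g_metric L. Qed.

Lemma g_unit x : A x -> g x \in unitmx.
Proof. by move=> Ax; have [_ /(_ c x Ax) [_ /lorentz_unit]] := lp_g_metric L. Qed.

Lemma smooth_xi : smooth_on A xi.
Proof. by have [+ _] := lp_xi_field L; apply. Qed.

Let LC := lp_nabla_levi_civita L c.

Lemma smooth_G i j : smooth_on A (fun x => G x i j).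
Proof. exact: lc_smooth LC i j. Qed.

Section AtPoint.
Variable x : V.
Hypothesis Ax : A x.
Local Notation "<< u , v >>" := (bil (g x) u v).
Let symg := g_sym Ax.

Lemma ev_xi : ev (eta x) (xi x) = -1.
Proof. exact: lp_eta_xi. Qed.

Lemma evZ a u : ev (eta x) (a *: u) = a * ev (eta x) u.
Proof. by rewrite /ev -scalemxAl mxE. Qed.

Lemma ev0 : ev (eta x) 0 = 0.
Proof. by rewrite /ev mul0mx mxE. Qed.

(** [phi^2] kills [xi], hence also [phi xi]; the formula for [phi^2] at [phi xi] then makes [phi xi]
    a multiple [- a xi], and [phi^2 xi = a^2 xi = 0] forces [a = 0]. *)
Lemma phi_xi : xi x *m phi x = 0.
Proof.
have p2 : xi x *m phi x *m phi x = 0.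
  by rewrite lp_phi2 // ev_xi scaleN1r subrr.
have := lp_phi2 L Ax (xi x *m phi x); rewrite p2 mul0mx => /esym/eqP.
move: (ev (eta x) (xi x *m phi x)) => a; rewrite addr_eq0 => /eqP E; have := p2.
rewrite E mulNmx -scalemxAl E scalerN opprK scalerA => /(congr1 (ev (eta x))).
rewrite evZ ev_xi ev0 mulrN1 => /eqP; rewrite oppr_eq0 mulf_eq0 orbb => /eqP ->.
by rewrite scale0r oppr0.
Qed.

Lemma g_xi u : << u, xi x >> = ev (eta x) u.
Proof.
have := lp_g_phi L Ax u (xi x); rewrite phi_xi bil0r ev_xi mulrN1 => /esym/eqP.
by rewrite subr_eq0 => /eqP.
Qed.

Lemma g_xi_xi : << xi x, xi x >> = -1.
Proof. by rewrite g_xi ev_xi. Qed.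

Lemma phi_phi u : u *m phi x *m phi x = u + << u, xi x >> *: xi x.
Proof. by rewrite lp_phi2 // g_xi. Qed.

Lemma g_phi_phi u v : << u *m phi x, v *m phi x >> = << u, v >> + << u, xi x >> * << v, xi x >>.
Proof. by rewrite lp_g_phi // !g_xi. Qed.

(** Compare the two ways of computing [phi^3 u], with [phi^2] applied last or first. *)
Lemma g_phi_xi u : << u *m phi x, xi x >> = 0.
Proof.
have := phi_phi (u *m phi x); rewrite (phi_phi u) mulmxDl -scalemxAl phi_xi scaler0.
move/addrI => /esym /(congr1 (fun w => << w, xi x >>)).
by rewrite bilZl g_xi_xi bil0l mulrN1 => /eqP; rewrite oppr_eq0 => /eqP.
Qed.

Lemma phi_sym u v : << u *m phi x, v >> = << u, v *m phi x >>.
Proof.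
have := g_phi_phi u (v *m phi x); rewrite phi_phi g_phi_xi mulr0 addr0 => <-.
by rewrite bilDr bilZr g_phi_xi mulr0 addr0.
Qed.

End AtPoint.

Section Covariant.
Variable x : V.
Hypothesis Ax : A x.
Local Notation "<< u , v >>" := (bil (g x) u v).
Let symg := g_sym Ax.

(** Differentiating [phi xi = 0] gives [phi (nabla_u xi) = phi^2 u]. Apply [phi] once more:
    [nabla_u xi] and [phi u] are both orthogonal to [xi], where [phi^2] is the identity. *)
Lemma cov_xi u : cov G (cst u) xi x = u *m phi x.
Proof.
have g0 : << cov G (cst u) xi x, xi x >> = 0.
  have := lc_derive LC (cst u) smooth_xi smooth_xi Ax.
  have -> : 'D_u (fun y => bil (g y) (xi y) (xi y)) x = 0.
    rewrite (@eq_on_derive _ _ _ A _ (cst (-1 : R)) x u oA) ?derive_cst // => y Ay.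
    exact: g_xi_xi.
  by rewrite (bilC (xi x)) // => E; lra.
have := lp_nabla_phi L (smooth_cst A u) smooth_xi Ax.
rewrite (@eq_cov R n A G oA (cst u) (cst u) (fun y => xi y *m phi y) (cst 0) x) //; last by move=> y; exact: phi_xi.
rewrite cov_cst gamma0r sub0r phi_xi // bil0r scale0r add0r lp_eta_xi // scaleN1r.
move=> /oppr_inj /(congr1 (mulmx^~ (phi x))); rewrite phi_phi // g0 scale0r addr0 => ->.
by rewrite phi_phi // g_phi_xi // scale0r addr0.
Qed.

End Covariant.

Section Curvature.
Variable x : V.
Hypothesis Ax : A x.
Local Notation "<< u , v >>" := (bil (g x) u v).
Let symg := g_sym Ax.

(** The structure equation for [(nabla_u phi) v] with [phi^2], [g(phi u, phi v)] and [eta] expanded,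
    so that only [g] and [xi] occur. *)
Definition nabla_phi_at x u v : V :=
  (<< u, v >> + << u, xi x >> * << v, xi x >>) *: xi x + << v, xi x >> *: (u + << u, xi x >> *: xi x).

Lemma cov_phi u Y : smooth_on A Y ->
  cov G (cst u) (fun y => Y y *m phi y) x =
  cov G (cst u) Y x *m phi x + nabla_phi_at x u (Y x).
Proof.
move=> sY; have := lp_nabla_phi L (smooth_cst A u) sY Ax.
rewrite -g_xi // phi_phi // g_phi_phi // => E.
by rewrite /nabla_phi_at -[X in _ + X]E addrC subrK.
Qed.

(** As [nabla xi = phi], the left-hand side is [(nabla_u phi) v - (nabla_v phi) u], whose multiples
    of [xi] cancel. *)
Lemma curv_xi u v : curv_at G x u v (xi x) = << v, xi x >> *: u - << u, xi x >> *: v.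
Proof.
have -> : curv_at G x u v (xi x) = curv G (cst u) (cst v) xi x.
  by rewrite (curv_tensor oA smooth_G) //; [exact: smooth_cst|exact: smooth_cst|exact: smooth_xi].
rewrite (curv_cst G u v Ax smooth_xi).
rewrite (@eq_cov R n A G oA (cst u) (cst u) _ (fun y => v *m phi y) x) //; last first.
  by move=> y Ay; rewrite cov_xi.
rewrite (@eq_cov R n A G oA (cst v) (cst v) _ (fun y => u *m phi y) x) //; last first.
  by move=> y Ay; rewrite cov_xi.
rewrite (@cov_phi u (cst v)) ?(@cov_phi v (cst u)); try exact: smooth_cst.
rewrite !cov_cst (gamma_sym LC v u Ax) /nabla_phi_at (bilC v u) //.
by apply/matrixP => i j; rewrite !mxE; ring.
Qed.

(** Pair symmetry and skewness move [xi] to the third slot, where [curv_xi] applies. *)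
Lemma curv_xi_mid u w : curv_at G x u (xi x) w = << w, xi x >> *: u - << u, w >> *: xi x.
Proof.
apply: (bil_inj (g_unit Ax)) => z.
rewrite (curv_pair oA LC smooth_g g_sym) // (curv_skew2 oA LC smooth_g g_sym) //.
rewrite curv_xi !(bilDl, bilNl, bilZl) (bilC (xi x) z) // (bilC w u) // (bilC z u) //; ring.
Qed.

End Curvature.
End LPSasakianChart.

(** * Curvature in dimension four *)

Section Traces.
Context (R : realType) (n : nat).
Local Notation V := 'rV[R]_n.
Implicit Types (g : 'M[R]_n) (u v w : V).

Lemma trace_id : \sum_k (delta_mx 0 k : V) 0 k = n%:R.
Proof.
under eq_bigr do rewrite mxE !eqxx.
by rewrite sumr_const card_ord.
Qed.

Lemma trace_rank1 g u v : \sum_k (bil g (delta_mx 0 k) u *: v) 0 k = bil g v u.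
Proof.
rewrite {2}(row_sum_delta v) bil_sum; apply: eq_bigr => k _.
by rewrite mxE bilZl mulrC.
Qed.

(** In matrix form [F g] is skew, so [F = - g F^T g^-1] has trace [- tr F]. *)
Lemma trace_skew g (f : V -> V) : g \in unitmx -> g^T = g ->
  (forall u v, bil g (f u) v = - bil g (f v) u) ->
  \sum_k f (delta_mx 0 k) 0 k = 0.
Proof.
move=> ug sg sk; pose F := \matrix_k f (delta_mx 0 k).
have FE k : f (delta_mx 0 k) = row k F by rewrite rowK.
have E : F *m g = - (F *m g)^T.
  apply/matrixP => i j; have := sk (delta_mx 0 i) (delta_mx 0 j).
  rewrite !FE /bil !trmx_delta -!colE.
  by rewrite -!row_mul !mxE.
have -> : \sum_k f (delta_mx 0 k) 0 k = \tr F.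
  by apply: eq_bigr => k _; rewrite FE mxE.
have : F = - (g *m F^T *m invmx g).
  by rewrite -[LHS](mulmxK ug F) E trmx_mul sg mulNmx.
move=> /(congr1 mxtrace); rewrite raddfN /= mxtrace_mulC mulmxA mulVmx // mul1mx mxtrace_tr.
by move=> H; lra.
Qed.

End Traces.

Section Dim4.
Context (R : realType) (M : smooth_manifold R 4) (L : lp_sasakian M) (c : atlas M).
Local Notation V := 'rV[R]_4.
Local Notation A := (cimg (mchart c)).
Local Notation G := (lp_nabla L c).
Local Notation g := (lp_g L c).
Local Notation phi := (lp_phi L c).
Local Notation xi := (lp_xi L c).
Local Notation S := (ricci G).
Local Notation r := (scal G g).
Implicit Types (X Y Z : V -> V) (x u v w z : V).
Let oA := @open_cimg R 4 M c.
Let LC := lp_nabla_levi_civita L c.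
Let sG := smooth_G L c.
Let sg := smooth_g L c.
Let symg := @g_sym R 4 M L c.

Section AtPoint.
Variable x : V.
Hypothesis Ax : A x.
Local Notation "<< u , v >>" := (bil (g x) u v).
Let sgx := symg Ax.

Lemma ricciE u v : bil (S x) u v = \sum_k curv_at G x (delta_mx 0 k) u v 0 k.
Proof.
rewrite {1}(row_sum_delta u) bil_sum.
under eq_bigr => i _.
  rewrite bilZl {1}(row_sum_delta v).
  rewrite (_ : bil _ _ _ = \sum_j v 0 j * S x i j); last first.
    rewrite (big_morph (bil (S x) (delta_mx 0 i)) (bilDr _ _) (bil0r _ _)).
    by apply: eq_bigr => j _; rewrite bilZr bil_delta.
  over.
under [RHS]eq_bigr => k _.
  rewrite {1}(row_sum_delta u) (big_morph (fun u => curv_at G x (delta_mx 0 k) u v)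
     (fun u v => curvDm oA sG Ax _ u v _) (_ : curv_at G x (delta_mx 0 k) 0 v = 0)); last first.
    by have := curvZm oA sG Ax 0 (delta_mx 0 k) 0 v; rewrite !scale0r.
  rewrite summxE.
  under eq_bigr => i _.
    rewrite (curvZm oA sG Ax) mxE {1}(row_sum_delta v) (big_morph (curv_at G x (delta_mx 0 k) (delta_mx 0 i))
     (fun u v => curvDr oA sG Ax _ _ u v) (_ : curv_at G x (delta_mx 0 k) (delta_mx 0 i) 0 = 0)); last first.
      by have := curvZr oA sG Ax 0 (delta_mx 0 k) (delta_mx 0 i) 0; rewrite !scale0r.
    rewrite summxE.
    under eq_bigr => j _ do rewrite (curvZr oA sG Ax) mxE.
    over.
  over.
rewrite [RHS]exchange_big; apply: eq_bigr => i _ /=; rewrite -mulr_sumr; congr (_ * _).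
rewrite exchange_big; apply: eq_bigr => j _ /=; rewrite -mulr_sumr; congr (_ * _).
by rewrite mxE.
Qed.

(** By the first Bianchi identity the difference of the two sides is, up to sign, the trace of the
    endomorphism [R(u, v)], which is skew for [g]. *)
Lemma ricci_sym u v : bil (S x) u v = bil (S x) v u.
Proof.
apply/eqP; rewrite -subr_eq0 !ricciE -sumrB; apply/eqP.
rewrite (eq_bigr (fun k => - curv_at G x u v (delta_mx 0 k) 0 k)) => [|k _].
  rewrite sumrN (trace_skew (g_unit L Ax) sgx) ?oppr0 // => p q.
  by rewrite (curv_skew2 oA LC sg symg).
have := bianchi1 oA LC (delta_mx 0 k) u v Ax.
rewrite (curv_atC G v (delta_mx 0 k) u Ax).
do 3 move: (curv_at _ _ _ _ _) => ?; move=> /rowP /(_ k); rewrite !mxE => E; lra.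
Qed.

(** The trace of [x |-> eta(u) x - eta(x) u], whence the factor 4 - 1. *)
Lemma ricci_xi u : bil (S x) u (xi x) = 3 * << u, xi x >>.
Proof.
rewrite ricciE (eq_bigr (fun k => << u, xi x >> * (delta_mx 0 k : V) 0 k
    - (<< delta_mx 0 k, xi x >> *: u) 0 k)) => [|k _]; last first.
  by rewrite (curv_xi L Ax) !mxE.
rewrite sumrB -mulr_sumr trace_id trace_rank1; ring.
Qed.

Lemma ricci_opP u v : << u *m ricci_op G g x, v >> = bil (S x) u v.
Proof. by rewrite /bil /ricci_op mulmxA mulmxKV // g_unit. Qed.

Lemma ricci_op_xi : xi x *m ricci_op G g x = 3 *: xi x.
Proof.
apply: (bil_inj (g_unit L Ax)) => v.
by rewrite ricci_opP ricci_sym ricci_xi bilZl (bilC v).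
Qed.

Lemma fourB2 : ((4%:R : R) - 2)^-1 = 2^-1.
Proof. by congr (_^-1); ring. Qed.

Lemma fourB12 : (4%:R - 1) * (4%:R - 2) = 6 :> R.
Proof. by ring. Qed.

(** Because [g(xi, xi) = -1], the plus sign makes [hproj] the orthogonal projection along [xi];
    [hform] is the [g]-product of two projections. *)
Definition hproj x u : V := u + bil (g x) u (xi x) *: xi x.
Definition hform x u v : R := bil (g x) u v + bil (g x) u (xi x) * bil (g x) v (xi x).

(* With [mu = k e^{-2t}] this is the curvature of [-dt^2 + e^{2t} h_k], [h_k] of
   constant curvature [k]. *)
Definition warped_curv (mu : R) : Prop := forall u v w,
  curv_at G x u v w = (<< v, w >> *: u - << u, w >> *: v) +
    mu *: (hform x v w *: hproj x u - hform x u w *: hproj x v).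

(** [R(u, xi) xi] is known for every LP-Sasakian metric, so [C(u, xi) xi = 0] can be solved for the
    Ricci operator. Once [Q] and [S] are explicit in [r], the equation [C = 0] determines [R]. *)
Lemma conformal_flat_warped :
  (forall u v w, conformal G g (cst u) (cst v) (cst w) x = 0) ->
  warped_curv (r x / 6 - 2).
Proof.
rewrite /conformal /ricci_part /metric_part /= fourB2 fourB12 => C0.
have Q u : u *m ricci_op G g x = (r x / 3 - 1) *: u + ((r x / 3 - 4) * << u, xi x >>) *: xi x.
  have := C0 u (xi x) (xi x).
  rewrite -/(curv_at G x u (xi x) (xi x)) (curv_xi L Ax) ricci_op_xi // !ricci_xi g_xi_xi //.
  move: (u *m _) => q /rowP E; apply/rowP => k; move: (E k); rewrite !mxE => {}E; lra.
have S' u v : bil (S x) u v = (r x / 3 - 1) * << u, v >> + (r x / 3 - 4) * << u, xi x >> * << v, xi x >>.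
  by rewrite -ricci_opP Q bilDl !bilZl (bilC (xi x) v) //; ring.
move=> u v w; have := C0 u v w; rewrite -/(curv_at G x u v w) !Q !S'.
move: (curv_at _ _ _ _ _) => q /rowP E; apply/rowP => k; move: (E k); rewrite /hform /hproj !mxE => {}E; lra.
Qed.

(* Contracting gives [(a + 2 b) (scal - 12) = 0].  If [a + 2 b = 0] the
   quasi-conformal tensor is [a] times the conformal one; otherwise
   [scal = 12] and [R] has constant curvature 1. *)
Lemma quasi_flat_warped a b : a * b != 0 ->
  (forall u v w, quasi_conformal G g a b (cst u) (cst v) (cst w) x = 0) ->
  warped_curv (r x / 6 - 2).
Proof.
rewrite mulf_eq0 negb_or => /andP[a0 b0] C0.
have [ab|ab] := eqVneq (a + 2 * b) 0.
  apply: conformal_flat_warped => u v w; have := C0 u v w.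
  have -> : a = - 2 * b by lra.
  rewrite /quasi_conformal /conformal fourB2 fourB12.
  move: (curv _ _ _ _ _) (ricci_part _ _ _ _ _ _) (metric_part _ _ _ _ _) => U P N.
  move=> /(congr1 (fun w => (- 2 * b)^-1 *: w)); rewrite scaler0 => <-.
  by apply/rowP => k; rewrite !mxE; field; rewrite ?mulf_neq0 // oppr_eq0.
rewrite /quasi_conformal /ricci_part /metric_part /= in C0.
pose rho := r x / 4%:R * (a / (4%:R - 1) + 2 * b).
have rhoE : rho = r x * a / 12 + r x * b / 2 by rewrite /rho; field.
(* Solve the flatness equation at [(u, xi, xi)] for [Q u], which occurs there with coefficient
   [- b]. *)
have Q u : u *m ricci_op G g x = ((rho - a - 3 * b) / b) *: u
    + ((rho - a - 6 * b) / b * << u, xi x >>) *: xi x.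
  have := C0 u (xi x) (xi x); rewrite -/rho.
  rewrite -/(curv_at G x u (xi x) (xi x)) (curv_xi L Ax) ricci_op_xi // !ricci_xi g_xi_xi //.
  move: (u *m _) => q /rowP E; apply/rowP => k; move: (E k); rewrite !mxE => {}E.
  apply: (mulfI b0).
  rewrite [RHS](_ : _ = (rho - a - 3 * b) * u 0 k + (rho - a - 6 * b) * << u, xi x >> * xi x 0 k);
    last by field.
  lra.
have r12 : r x = 12.
  have : r x = \sum_k ((delta_mx 0 k : V) *m ricci_op G g x) 0 k.
    by rewrite /scal /mxtrace; apply: eq_bigr => k _; rewrite -rowE [RHS]mxE.
  rewrite (eq_bigr (fun k => (rho - a - 3 * b) / b * (delta_mx 0 k : V) 0 k
      + (rho - a - 6 * b) / b * (<< delta_mx 0 k, xi x >> *: xi x) 0 k)) => [|k _]; last first.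
    by rewrite Q !mxE; ring.
  rewrite big_split -!mulr_sumr /= trace_id trace_rank1 g_xi_xi // => /(congr1 (fun t => t * b)).
  rewrite mulrDl -!mulrA !(mulrCA b^-1) mulVf // => E.
  have : (a + 2 * b) * (r x - 12) = 0 by lra.
  by move/eqP; rewrite mulf_eq0 (negbTE ab) subr_eq0 => /eqP.
have {}Q u : u *m ricci_op G g x = 3 *: u.
  rewrite Q rhoE r12 (_ : _ / b = 3); last by field.
  by rewrite (_ : (_ - 6 * b) / b = 0) ?mul0r ?scale0r ?addr0 //; field.
have S' u v : bil (S x) u v = 3 * << u, v >> by rewrite -ricci_opP Q bilZl.
move=> u v w; have := C0 u v w; rewrite -/rho -/(curv_at G x u v w) !Q !S'.
rewrite rhoE r12; move: (curv_at _ _ _ _ _) => q /rowP E; apply/rowP => k.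
apply: (mulfI a0); move: (E k); rewrite (_ : 12 / 6 - 2 = 0); last by lra.
by rewrite scale0r addr0 !mxE => {}E; lra.
Qed.

End AtPoint.
End Dim4.

(** * Conformally symmetric manifolds *)

Section AlgebraicWeyl.
Context (R : realType).
Local Notation V := 'rV[R]_4.
Variables (g S Q : 'M[R]_4) (r : R) (Rm C : V -> V -> V -> V) (xi : V).
Local Notation "<< u , v >>" := (bil g u v).
Hypothesis ug : g \in unitmx.
Hypothesis sg : g^T = g.
Hypothesis symS : forall u v, bil S u v = bil S v u.
Hypothesis QS : forall u v, << u *m Q, v >> = bil S u v.
Hypothesis trQ : r = \sum_k ((delta_mx 0 k : V) *m Q) 0 k.
Hypothesis trR : forall v w, bil S v w = \sum_k Rm (delta_mx 0 k) v w 0 k.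
Hypothesis RDl : forall u u' v w, Rm (u + u') v w = Rm u v w + Rm u' v w.
Hypothesis RZl : forall a u v w, Rm (a *: u) v w = a *: Rm u v w.
Hypothesis Ranti : forall u v w, Rm u v w = - Rm v u w.
Hypothesis Rskew : forall u v w z, << Rm u v w, z >> = - << Rm u v z, w >>.
Hypothesis Rpair : forall u v w z, << Rm u v w, z >> = << Rm w z u, v >>.
Hypothesis Rbianchi : forall u v w, Rm u v w + Rm v w u + Rm w u v = 0.
Hypothesis CE : forall u v w, C u v w = Rm u v w - 2^-1 *: (<< v, w >> *: (u *m Q)
   - << u, w >> *: (v *m Q) + bil S v w *: u - bil S u w *: v)
   + (r / 6) *: (<< v, w >> *: u - << u, w >> *: v).
Implicit Types (u v w z : V).

Let bC u v : << u, v >> = << v, u >> := bilC u v sg.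

(** In this lowered form each symmetry of [C] follows from the same symmetry of [Rm] by polynomial
    algebra; nondegeneracy of [g] carries it back to vectors. *)
Lemma bil_weyl u v w z : << C u v w, z >> = << Rm u v w, z >>
  - 2^-1 * (<< v, w >> * bil S u z - << u, w >> * bil S v z
            + bil S v w * << u, z >> - bil S u w * << v, z >>)
  + r / 6 * (<< v, w >> * << u, z >> - << u, w >> * << v, z >>).
Proof. by rewrite CE !(bilDl, bilNl, bilZl) !QS. Qed.

Lemma weyl_anti u v w : C u v w = - C v u w.
Proof.
by apply: (bil_inj ug) => z; rewrite bilNl !bil_weyl (Ranti u v w) bilNl; ring.
Qed.

Lemma weyl_skew u v w z : << C u v w, z >> = - << C u v z, w >>.
Proof. by rewrite !bil_weyl Rskew; ring. Qed.

Lemma weyl_pair u v w z : << C u v w, z >> = << C w z u, v >>.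
Proof.
rewrite !bil_weyl Rpair (bC u w) (bC v w) (bC u z) (bC v z).
by rewrite (symS w u) (symS w v) (symS z u) (symS z v); ring.
Qed.

Lemma weyl_bianchi u v w : C u v w + C v w u + C w u v = 0.
Proof.
apply: (bil_inj ug) => z.
have : << Rm u v w, z >> + << Rm v w u, z >> + << Rm w u v, z >> = 0.
  by rewrite -!bilDl Rbianchi bil0l.
rewrite !bilDl bil0l !bil_weyl (bC v u) (bC w v) (bC w u).
by rewrite (symS v u) (symS w v) (symS w u) => E; lra.
Qed.

Lemma weylDl u u' v w : C (u + u') v w = C u v w + C u' v w.
Proof.
by apply: (bil_inj ug) => z; rewrite bilDl !bil_weyl RDl !bilDl; ring.
Qed.

Lemma weylZl a u v w : C (a *: u) v w = a *: C u v w.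
Proof.
by apply: (bil_inj ug) => z; rewrite bilZl !bil_weyl RZl !bilZl; ring.
Qed.

Lemma weylDm u v v' w : C u (v + v') w = C u v w + C u v' w.
Proof. by rewrite weyl_anti weylDl opprD -!weyl_anti. Qed.

Lemma weylZm a u v w : C u (a *: v) w = a *: C u v w.
Proof. by rewrite weyl_anti weylZl -scalerN -weyl_anti. Qed.

Lemma weylDr u v w w' : C u v (w + w') = C u v w + C u v w'.
Proof.
apply: (bil_inj ug) => z; rewrite bilDl (weyl_pair u v) weylDl bilDl.
by rewrite (weyl_pair w) (weyl_pair w').
Qed.

Lemma weylZr a u v w : C u v (a *: w) = a *: C u v w.
Proof.
by apply: (bil_inj ug) => z; rewrite bilZl (weyl_pair u v) weylZl bilZl (weyl_pair w).
Qed.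

Lemma weylBl u u' v w : C (u - u') v w = C u v w - C u' v w.
Proof. by rewrite weylDl -scaleN1r weylZl scaleN1r. Qed.
Lemma weylBm u v v' w : C u (v - v') w = C u v w - C u v' w.
Proof. by rewrite weylDm -scaleN1r weylZm scaleN1r. Qed.
Lemma weylBr u v w w' : C u v (w - w') = C u v w - C u v w'.
Proof. by rewrite weylDr -scaleN1r weylZr scaleN1r. Qed.

(** The coefficients 1/2 and 1/6 are those of dimension 4 for which the trace vanishes:
    [S - (r g + 2 S) / 2 + (r / 6) 3 g = 0]. *)
Lemma weyl_trace v w : \sum_k C (delta_mx 0 k) v w 0 k = 0.
Proof.
rewrite (eq_bigr (fun k => Rm (delta_mx 0 k) v w 0 k
  - 2^-1 * (<< v, w >> * ((delta_mx 0 k : V) *m Q) 0 k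
     - (<< delta_mx 0 k, w >> *: (v *m Q)) 0 k
     + bil S v w * (delta_mx 0 k : V) 0 k - (bil S (delta_mx 0 k) w *: v) 0 k)
  + r / 6 * (<< v, w >> * (delta_mx 0 k : V) 0 k - (<< delta_mx 0 k, w >> *: v) 0 k))) => [|k _]; last first.
  by rewrite CE; move: (Rm _ _ _) (_ *m Q) (_ *m Q) => p q s; rewrite !mxE.
rewrite !(big_split, sumrN) /= -!mulr_sumr !(big_split, sumrN) /= -!mulr_sumr.
rewrite -trR trace_id !trace_rank1 QS -trQ.
by field.
Qed.

Hypothesis xi_xi : << xi, xi >> = -1.
(* [C] is annihilated by the boosts [R(xi, x)]. *)
Hypothesis derivation : forall x u v w,
  << x, C u v w >> *: xi - << C u v w, xi >> *: x =
  C (<< x, u >> *: xi - << u, xi >> *: x) v w +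
  C u (<< x, v >> *: xi - << v, xi >> *: x) w +
  C u v (<< x, w >> *: xi - << w, xi >> *: x).

(* The trace of [derivation] over [x]. *)
Lemma weyl_xi u v w : << C u v w, xi >> = 0.
Proof.
have tr : \sum_k (<< delta_mx 0 k, C u v w >> *: xi - << C u v w, xi >> *: delta_mx 0 k) 0 k =
  << C xi v w, u >> + << C u xi w, v >> + << C u v xi, w >>.
  rewrite (eq_bigr (fun k => (<< delta_mx 0 k, u >> *: C xi v w) 0 k - << u, xi >> * C (delta_mx 0 k) v w 0 k
    + ((<< delta_mx 0 k, v >> *: C u xi w) 0 k + << v, xi >> * C (delta_mx 0 k) u w 0 k)
    + ((<< delta_mx 0 k, w >> *: C u v xi) 0 k - << w, xi >> * C u v (delta_mx 0 k) 0 k))) => [|k _]; last first.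
    rewrite derivation weylBl weylBm weylBr !(weylZl, weylZm, weylZr) (weyl_anti u (delta_mx 0 k)).
    by move: (C _ _ _) (C _ _ _) (C _ _ _) (C _ _ _) (C _ _ _) (C _ _ _) => *; rewrite !mxE; ring.
  rewrite !(big_split, sumrN) /= -!mulr_sumr !weyl_trace !trace_rank1.
  rewrite (trace_skew (f := C u v) ug sg); last by move=> p q; exact: weyl_skew.
  by ring.
move: tr.
rewrite (eq_bigr (fun k => (<< delta_mx 0 k, C u v w >> *: xi) 0 k - << C u v w, xi >> * (delta_mx 0 k : V) 0 k)) => [|k _]; last first.
  by rewrite !mxE.
rewrite big_split sumrN /= -mulr_sumr trace_rank1 trace_id (bC xi).
(* The traced left-hand side is [(1 - 4) <C u v w, xi>]. By the symmetries of [C] the right-hand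
   side is minus the cyclic sum of such terms, which the Bianchi identity annihilates. *)
have := congr1 (fun t => << t, xi >>) (weyl_bianchi u v w).
rewrite /= !bilDl bil0l.
rewrite (weyl_pair xi v w u) (weyl_skew w u xi v) (weyl_pair u xi w v).
rewrite (weyl_anti w v u) bilNl (weyl_skew u v xi w) => ? ?; lra.
Qed.

(** Pair [derivation] with [xi]: by [weyl_xi] every value of [C] is orthogonal to [xi], so only
    [<z, C u v w> <xi, xi>] survives. *)
Lemma weyl_zero u v w : C u v w = 0.
Proof.
apply: (bil_nondeg ug) => z.
have := congr1 (fun t => << t, xi >>) (derivation z u v w).
rewrite /= !(bilDl, bilNl, bilZl) !weyl_xi xi_xi (bC z) => E; lra.
Qed.

End AlgebraicWeyl.

Section ConformalTensor.
Context (R : realType) (M : smooth_manifold R 4) (L : lp_sasakian M) (c : atlas M).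
Local Notation V := 'rV[R]_4.
Local Notation A := (cimg (mchart c)).
Local Notation G := (lp_nabla L c).
Local Notation g := (lp_g L c).
Local Notation xi := (lp_xi L c).
Local Notation S := (ricci G).
Local Notation r := (scal G g).
Implicit Types (X Y Z : V -> V) (x u v w z : V).
Let oA := @open_cimg R 4 M c.
Let LC := lp_nabla_levi_civita L c.
Let sG := smooth_G L c.
Let sg := smooth_g L c.
Let symg := @g_sym R 4 M L c.

Definition conf_at x u v w := conformal G g (cst u) (cst v) (cst w) x.

Lemma conformal_tensor X Y Z x : smooth_on A X -> smooth_on A Y -> smooth_on A Z -> A x ->
  conformal G g X Y Z x = conf_at x (X x) (Y x) (Z x).
Proof.
by move=> sX sY sZ Ax; rewrite /conf_at /conformal (curv_tensor oA sG sX sY sZ Ax).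
Qed.

Lemma smooth_ricci_op : smooth_on A (ricci_op G g).
Proof.
apply: smooth_mulmx => //; first exact: smooth_ricci.
by apply: smooth_invmx => // x Ax; exact: g_unit.
Qed.

Lemma smooth_scal : smooth_on A r.
Proof. by apply: smooth_sum => // i; apply: smooth_entry => //; exact: smooth_ricci_op. Qed.

Lemma smooth_conformal X Y Z : smooth_on A X -> smooth_on A Y -> smooth_on A Z ->
  smooth_on A (conformal G g X Y Z).
Proof.
move=> sX sY sZ.
have sS : smooth_on A S by exact: smooth_ricci.
have sQ := smooth_ricci_op.
have sb (B : V -> 'M[R]_4) X' Y' (Z' : V -> V) : smooth_on A B -> smooth_on A X' -> smooth_on A Y' ->
    smooth_on A Z' -> smooth_on A (fun x => bil (B x) (X' x) (Y' x) *: Z' x).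
  by move=> *; apply: smooth_scalemx => //; exact: smooth_bil.
have sXQ X' : smooth_on A X' -> smooth_on A (fun x => X' x *m ricci_op G g x).
  by move=> *; exact: smooth_mulmx.
apply: smoothD => //; first apply: smoothB => //.
- exact: smooth_curv.
- apply: smooth_scalemx => //; first exact: smooth_cst.
  apply: smoothB => //; last exact: sb.
  apply: smoothD => //; last exact: sb.
  by apply: smoothB => //; apply: sb => //; exact: sXQ.
- apply: smooth_scalemx => //; last by apply: smoothB => //; exact: sb.
  by apply: smoothM => //; [exact: smooth_scal|exact: smooth_cst].
Qed.

Section AtPoint.
Variable x : V.
Hypothesis Ax : A x.
Local Notation "<< u , v >>" := (bil (g x) u v).
Local Notation C := (conf_at x).
Let sgx := symg Ax.

Lemma conf_atE u v w : C u v w = curv_at G x u v w - 2^-1 *: (<< v, w >> *: (u *m ricci_op G g x)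
   - << u, w >> *: (v *m ricci_op G g x) + bil (S x) v w *: u - bil (S x) u w *: v)
   + (r x / 6) *: (<< v, w >> *: u - << u, w >> *: v).
Proof. by rewrite /conf_at /conformal fourB2 fourB12. Qed.

Let ug := g_unit L Ax.
Let RDl u u' v w := curvDl oA sG Ax u u' v w.
Let RZl a u v w := curvZl oA sG Ax a u v w.
Let Ranti u v w := curv_atC G u v w Ax.
Let Rskew u v w z := curv_skew2 oA LC sg symg u v w z Ax.
Let Rpair u v w z := curv_pair oA LC sg symg u v w z Ax.
Let Rbianchi u v w := bianchi1 oA LC u v w Ax.
Let QS u v := ricci_opP L Ax u v.
Let symS u v := ricci_sym L Ax u v.
Let trR u v := ricciE L Ax u v.

Lemma scal_trace : r x = \sum_k ((delta_mx 0 k : V) *m ricci_op G g x) 0 k.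
Proof. by rewrite /scal /mxtrace; apply: eq_bigr => k _; rewrite -rowE [RHS]mxE. Qed.

Definition confBl := weylBl ug QS RDl RZl conf_atE.
Definition confBm := weylBm ug QS RDl RZl Ranti conf_atE.
Definition confBr := weylBr ug sgx symS QS RDl RZl Rpair conf_atE.

Lemma conf_zero :
  (forall u v a b d, curv_at G x u v (C a b d) =
     C (curv_at G x u v a) b d + C a (curv_at G x u v b) d + C a b (curv_at G x u v d)) ->
  forall u v w, C u v w = 0.
Proof.
move=> RC; apply: (weyl_zero (xi := xi x) ug sgx symS QS scal_trace trR RDl RZl Ranti Rskew Rpair
  Rbianchi conf_atE); first exact: g_xi_xi.
have E p q : << p, q >> *: xi x - << q, xi x >> *: p = curv_at G x (xi x) p q.
  by rewrite Ranti (curv_xi_mid L Ax) opprB.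
move=> p u v w; have := RC (xi x) p u v w; rewrite -!E; exact.
Qed.

End AtPoint.

Section RicciIdentity.
Hypothesis H : forall W X Y Z, smooth_on A W -> smooth_on A X -> smooth_on A Y ->
  smooth_on A Z -> forall x, A x -> nabla_conformal G g W X Y Z x = 0.

Lemma cov_conformal u X Y Z x : smooth_on A X -> smooth_on A Y -> smooth_on A Z -> A x ->
  cov G (cst u) (conformal G g X Y Z) x =
  conformal G g (cov G (cst u) X) Y Z x + conformal G g X (cov G (cst u) Y) Z x
  + conformal G g X Y (cov G (cst u) Z) x.
Proof.
move=> sX sY sZ Ax; have := H (smooth_cst A u) sX sY sZ Ax; rewrite /nabla_conformal.
move: (cov _ _ (conformal _ _ _ _ _) _) (conformal _ _ _ _ _ _) (conformal _ _ _ _ _ _) (conformal _ _ _ _ _ _).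
by move=> p q s t /rowP E; apply/rowP => k; move: (E k); rewrite !mxE => {}E; lra.
Qed.

(** The Ricci identity for a parallel tensor. Differentiating [C(a, b, d)] twice by the Leibniz rule
    produces nine terms; the six in which two different slots are differentiated cancel on
    antisymmetrization, the other three assemble into curvatures. *)
Lemma conf_ricci x u v a b d : A x -> curv_at G x u v (conf_at x a b d) =
  conf_at x (curv_at G x u v a) b d + conf_at x a (curv_at G x u v b) d
  + conf_at x a b (curv_at G x u v d).
Proof.
move=> Ax.
have sc e := smooth_cst A (e : V).
have scv e Y : smooth_on A Y -> smooth_on A (cov G (cst e) Y).
  exact: (smooth_cov_cst oA sG).
have sF : smooth_on A (conformal G g (cst a) (cst b) (cst d)) by exact: smooth_conformal.
have E2 e f : cov G (cst e) (cov G (cst f) (conformal G g (cst a) (cst b) (cst d))) x =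
    conf_at x (cov G (cst e) (cov G (cst f) (cst a)) x) b d
    + conf_at x (cov G (cst f) (cst a) x) (cov G (cst e) (cst b) x) d
    + conf_at x (cov G (cst f) (cst a) x) b (cov G (cst e) (cst d) x)
    + (conf_at x (cov G (cst e) (cst a) x) (cov G (cst f) (cst b) x) d
    + conf_at x a (cov G (cst e) (cov G (cst f) (cst b)) x) d
    + conf_at x a (cov G (cst f) (cst b) x) (cov G (cst e) (cst d) x))
    + (conf_at x (cov G (cst e) (cst a) x) b (cov G (cst f) (cst d) x)
    + conf_at x a (cov G (cst e) (cst b) x) (cov G (cst f) (cst d) x)
    + conf_at x a b (cov G (cst e) (cov G (cst f) (cst d)) x)).
  have s1 : smooth_on A (conformal G g (cov G (cst f) (cst a)) (cst b) (cst d)).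
    by apply: smooth_conformal => //; exact: scv.
  have s2 : smooth_on A (conformal G g (cst a) (cov G (cst f) (cst b)) (cst d)).
    by apply: smooth_conformal => //; exact: scv.
  have s3 : smooth_on A (conformal G g (cst a) (cst b) (cov G (cst f) (cst d))).
    by apply: smooth_conformal => //; exact: scv.
  rewrite (@eq_cov R 4 A G oA (cst e) (cst e) _ (fun y =>
    conformal G g (cov G (cst f) (cst a)) (cst b) (cst d) y +
    conformal G g (cst a) (cov G (cst f) (cst b)) (cst d) y +
    conformal G g (cst a) (cst b) (cov G (cst f) (cst d)) y) x) //; last first.
    by move=> y Ay; exact: (cov_conformal f (sc a) (sc b) (sc d) Ay).
  have d1 := smooth_differentiable s1 Ax; have d2 := smooth_differentiable s2 Ax.
  have d3 := smooth_differentiable s3 Ax.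
  have -> := @covD R 4 G (cst e) _ _ x (differentiableD d1 d2) d3.
  have -> := @covD R 4 G (cst e) _ _ x d1 d2.
  rewrite (cov_conformal e (scv f _ (sc a)) (sc b) (sc d) Ax).
  rewrite (cov_conformal e (sc a) (scv f _ (sc b)) (sc d) Ax).
  rewrite (cov_conformal e (sc a) (sc b) (scv f _ (sc d)) Ax).
  have sc2 p q z := scv p _ (scv q _ (sc z)); have sc1 p z := scv p _ (sc z).
  rewrite (conformal_tensor (sc2 e f a) (sc b) (sc d) Ax).
  rewrite (conformal_tensor (sc1 f a) (sc1 e b) (sc d) Ax).
  rewrite (conformal_tensor (sc1 f a) (sc b) (sc1 e d) Ax).
  rewrite (conformal_tensor (sc1 e a) (sc1 f b) (sc d) Ax).
  rewrite (conformal_tensor (sc a) (sc2 e f b) (sc d) Ax).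
  rewrite (conformal_tensor (sc a) (sc1 f b) (sc1 e d) Ax).
  rewrite (conformal_tensor (sc1 e a) (sc b) (sc1 f d) Ax).
  rewrite (conformal_tensor (sc a) (sc1 e b) (sc1 f d) Ax).
  by rewrite (conformal_tensor (sc a) (sc b) (sc2 e f d) Ax).
have -> : curv_at G x u v (conf_at x a b d) = curv G (cst u) (cst v) (conformal G g (cst a) (cst b) (cst d)) x.
  by rewrite (curv_tensor oA sG (sc u) (sc v) sF Ax) conformal_tensor.
rewrite (curv_cst G u v Ax sF) (E2 u v) (E2 v u) /curv_at.
rewrite !(curv_cst G u v Ax (sc _)) confBl // confBm // confBr //.
do 12! move: (conf_at x _ _ _) => ?.
by apply/rowP => k; rewrite !mxE; ring.
Qed.
End RicciIdentity.

Lemma conformally_symmetric_flat : conformally_symmetric L ->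
  forall x u v w, A x -> conf_at x u v w = 0.
Proof.
move=> H x u v w Ax; apply: conf_zero => // p q a b d.
by apply: conf_ricci => // W X Y Z sW sX sY sZ y Ay; exact: H.
Qed.

End ConformalTensor.

(** * Second Bianchi identity *)

Section SecondBianchi.
Context (R : realType) (n : nat).
Local Notation V := 'rV[R]_n.
Variables (A : set V) (G : V -> 'I_n -> 'I_n -> V).
Hypothesis oA : open A.
Hypothesis sG : forall i j, smooth_on A (fun x => G x i j).
Implicit Types (x u v w z : V).

(** Brackets of constant fields vanish, so the right-hand side is the double commutator of [nabla_u]
    with [[nabla_v, nabla_w]], and the second Bianchi identity becomes the Jacobi identity. The
    left-hand side is [(nabla_u R)(v, w) z] up to the terms [R(nabla_u v, w) z] and
    [R(v, nabla_u w) z]. *)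
Lemma bianchi2_term x u v w z : A x ->
  cov G (cst u) (curv G (cst v) (cst w) (cst z)) x
    - curv_at G x v w (gamma_at (G x) u z) =
  cov G (cst u) (cov G (cst v) (cov G (cst w) (cst z))) x
  - cov G (cst u) (cov G (cst w) (cov G (cst v) (cst z))) x
  - (cov G (cst v) (cov G (cst w) (cov G (cst u) (cst z))) x
  - cov G (cst w) (cov G (cst v) (cov G (cst u) (cst z))) x).
Proof.
move=> Ax.
have sc e := smooth_cst A (e : V).
have s1 p q := smooth_cov_cst oA sG p (sc q).
have s2 p q s := smooth_cov_cst oA sG p (s1 q s).
rewrite -(cov_cst G u z x) -(curv_tensor oA sG (sc v) (sc w) (s1 u z) Ax).
rewrite (curv_cst G v w Ax (s1 u z)); congr (_ - _).
rewrite (@eq_cov R n A G oA (cst u) (cst u) _ (fun y => cov G (cst v) (cov G (cst w) (cst z)) y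
  - cov G (cst w) (cov G (cst v) (cst z)) y) x) //; last first.
  by move=> y Ay; exact: (curv_cst G v w Ay (sc z)).
exact: covB (smooth_differentiable (s2 _ _ _) Ax) (smooth_differentiable (s2 _ _ _) Ax).
Qed.

Lemma bianchi2 x u v w z : A x ->
  (cov G (cst u) (curv G (cst v) (cst w) (cst z)) x - curv_at G x v w (gamma_at (G x) u z)) +
  (cov G (cst v) (curv G (cst w) (cst u) (cst z)) x - curv_at G x w u (gamma_at (G x) v z)) +
  (cov G (cst w) (curv G (cst u) (cst v) (cst z)) x - curv_at G x u v (gamma_at (G x) w z)) = 0.
Proof.
move=> Ax; apply: etrans (congr2 +%R (congr2 +%R (bianchi2_term u v w z Ax)
  (bianchi2_term v w u z Ax)) (bianchi2_term w u v z Ax)) _.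
do 6 move: (cov G _ (cov G _ (cov _ _ _)) x) => ?.
by apply/rowP => k; rewrite !mxE; ring.
Qed.

End SecondBianchi.

Section WarpedBianchi.
Context (R : realType) (M : smooth_manifold R 4) (L : lp_sasakian M) (c : atlas M).
Local Notation V := 'rV[R]_4.
Local Notation A := (cimg (mchart c)).
Local Notation G := (lp_nabla L c).
Local Notation g := (lp_g L c).
Local Notation phi := (lp_phi L c).
Local Notation xi := (lp_xi L c).
Implicit Types (x u v w z : V).
Let oA := @open_cimg R 4 M c.
Let LC := lp_nabla_levi_civita L c.
Let sG := smooth_G L c.
Let sg := smooth_g L c.
Let symg := @g_sym R 4 M L c.

(** Tracing [warped_curv] gives [S = 3 g + 2 mu h], hence scalar curvature [12 + 6 mu]. Defining
    [mu] through the scalar curvature makes it a smooth function that can be differentiated. *)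
Definition warp x : R := scal G g x / 6 - 2.

Lemma smooth_warp : smooth_on A warp.
Proof.
apply: smoothB => //; last exact: smooth_cst.
by apply: smoothM => //; [exact: smooth_scal|exact: smooth_cst].
Qed.

Lemma warped_of_flatness :
  conformally_flat L \/ quasi_conformally_flat L \/ conformally_symmetric L ->
  forall x, A x -> warped_curv L c x (warp x).
Proof.
have sc e := smooth_cst A (e : V).
case=> [H|[[a [b [ab H]]]|H]] x Ax.
- by apply: conformal_flat_warped => // u v w; exact: H.
- by apply: (quasi_flat_warped Ax ab) => u v w; exact: H.
- by apply: conformal_flat_warped => // u v w; exact: (conformally_symmetric_flat H u v w Ax).
Qed.

Hypothesis Hw : forall x, A x -> warped_curv L c x (warp x).

Lemma bil_warped x u v w z : A x -> bil (g x) (curv_at G x u v w) z =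
  bil (g x) v w * bil (g x) u z - bil (g x) u w * bil (g x) v z
  + warp x * (hform L c x v w * hform L c x u z - hform L c x u w * hform L c x v z).
Proof.
move=> Ax; rewrite Hw // /hform /hproj !(bilDl, bilZl, bilNl) (bilC (xi x) z (symg Ax)); ring.
Qed.

Section AtPoint.
Variable x : V.
Hypothesis Ax : A x.
Local Notation "<< u , v >>" := (bil (g x) u v).
Local Notation h := (hform L c x).
Local Notation Gam := (gamma_at (G x)).

(** This is [(nabla_u h)(v, w)]: [g] is parallel and [nabla_u xi = phi u]. *)
Definition nabla_hform u v w := << v, u *m phi x >> * << w, xi x >> + << v, xi x >> * << w, u *m phi x >>.

Lemma derive_g u v w : 'D_u (fun y => bil (g y) v w) x = << Gam u v, w >> + << v, Gam u w >>.
Proof.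
have := lc_derive LC (cst u) (smooth_cst A v) (smooth_cst A w) Ax.
by rewrite !cov_cst.
Qed.

Lemma derive_eta u v : 'D_u (fun y => bil (g y) v (xi y)) x = << Gam u v, xi x >> + << v, u *m phi x >>.
Proof.
have := lc_derive LC (cst u) (smooth_cst A v) (smooth_xi L c) Ax.
by rewrite cov_cst cov_xi.
Qed.

Lemma smooth_gcst v w : smooth_on A (fun y => bil (g y) v w).
Proof. by apply: smooth_bil => //; exact: smooth_cst. Qed.

Lemma smooth_etacst v : smooth_on A (fun y => bil (g y) v (xi y)).
Proof. by apply: smooth_bil => //; [exact: smooth_cst|exact: smooth_xi]. Qed.

Lemma smooth_hform v w : smooth_on A (fun y => hform L c y v w).
Proof.
by apply: smoothD => //; [exact: smooth_gcst|apply: smoothM => //; exact: smooth_etacst].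
Qed.

Let dg v w := smooth_differentiable (smooth_gcst v w) Ax.
Let deta v := smooth_differentiable (smooth_etacst v) Ax.
Let dhf v w := smooth_differentiable (smooth_hform v w) Ax.
Let dmu := smooth_differentiable smooth_warp Ax.

Lemma derive_hform u v w : 'D_u (fun y => hform L c y v w) x = h (Gam u v) w + h v (Gam u w) + nabla_hform u v w.
Proof.
rewrite /hform (deriveDf _ (dg v w) (differentiableM (deta v) (deta w))).
by rewrite (deriveMf _ (deta v) (deta w)) derive_g !derive_eta /nabla_hform; ring.
Qed.

Definition hform_sqr v w z t := h w z * h v t - h v z * h w t.

(** The covariant derivative along [u] of [mu h /\ h]; the constant curvature part [g /\ g] is
    parallel and contributes nothing. *)
Definition nabla_warped u v w z t := 'D_u warp x * hform_sqr v w z t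
  + warp x * (nabla_hform u w z * h v t + h w z * nabla_hform u v t - nabla_hform u v z * h w t - h v z * nabla_hform u w t).

Lemma cov_warped u v w z t :
  << cov G (cst u) (curv G (cst v) (cst w) (cst z)) x - curv_at G x v w (Gam u z), t >> =
  << curv_at G x (Gam u v) w z, t >> + << curv_at G x v (Gam u w) z, t >> + nabla_warped u v w z t.
Proof.
have sc e := smooth_cst A (e : V).
have sR : smooth_on A (curv G (cst v) (cst w) (cst z)) by exact: smooth_curv.
have := lc_derive LC (cst u) sR (sc t) Ax.
rewrite (@eq_on_derive _ _ _ A _ (fun y => (bil (g y) w z * bil (g y) v t - bil (g y) v z * bil (g y) w t)
   + warp y * (hform L c y w z * hform L c y v t - hform L c y v z * hform L c y w t)) x _ oA) //; last first.
  move=> y Ay.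
  by have := bil_warped v w z t Ay.
have dM p q (p' q' : V) := differentiableM (dg p q) (dg p' q').
have dN p q (p' q' : V) := differentiableM (dhf p q) (dhf p' q').
rewrite (deriveDf _ (differentiableB (dM w z v t) (dM v z w t))
  (differentiableM dmu (differentiableB (dN w z v t) (dN v z w t)))).
rewrite (deriveBf _ (dM w z v t) (dM v z w t)).
rewrite (deriveMf _ dmu (differentiableB (dN w z v t) (dN v z w t))).
rewrite (deriveBf _ (dN w z v t) (dN v z w t)).
rewrite !(deriveMf _ (dg _ _) (dg _ _)) !(deriveMf _ (dhf _ _) (dhf _ _)).
rewrite !derive_g !derive_hform => /esym E.
have B4 : << curv_at G x v w z, cov G (cst u) (cst t) x >> =
    << w, z >> * << v, Gam u t >> - << v, z >> * << w, Gam u t >>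
    + warp x * (h w z * h v (Gam u t) - h v z * h w (Gam u t)).
  rewrite (cov_cst G u t x); exact: (bil_warped v w z (Gam u t) Ax).
have {}E := etrans (congr1 (+%R _) (esym B4)) E.
have {}E := etrans (esym (addrK _ _)) (congr1 (fun s => s - _) E).
have {}E := etrans (congr2 (fun a b => a - b) E (bil_warped v w (Gam u z) t Ax)).
apply: etrans (bilDl _ _ _ _) _; apply: etrans (congr1 (+%R _) (bilNl _ _ _)) _; apply: E.
apply: etrans _ (esym (congr1 (fun s => s + _) (congr2 +%R
  (bil_warped (Gam u v) w z t Ax) (bil_warped v (Gam u w) z t Ax)))).
rewrite /nabla_warped /hform_sqr !mulrfctE /=; ring.
Qed.

(** The curvature terms with a Christoffel vector left over in [cov_warped] cancel in pairs over the
    cyclic sum, by the symmetry of the connection and the antisymmetry of the curvature. *)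
Lemma warped_bianchi u v w z t :
  nabla_warped u v w z t + nabla_warped v w u z t + nabla_warped w u v z t = 0.
Proof.
have cancel (a1 a2 a3 a4 a5 a6 d1 d2 d3 : R) : a1 + a2 + d1 + (a3 + a4 + d2) + (a5 + a6 + d3) = 0 ->
  a2 = - a5 -> a4 = - a1 -> a6 = - a3 -> d1 + d2 + d3 = 0 by move=> *; lra.
have E0 := congr1 (fun e => << e, t >>) (bianchi2 oA sG u v w z Ax).
have E1 := etrans (esym (bilDl _ _ _ _)) (etrans E0 (bil0l _ _)).
have E2 := etrans (congr1 (fun s => s + _) (esym (bilDl _ _ _ _))) E1.
have E := etrans (congr2 +%R (congr2 +%R (esym (cov_warped u v w z t)) (esym (cov_warped v w u z t)))
  (esym (cov_warped w u v z t))) E2.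
have C p q : << curv_at G x p q z, t >> = - << curv_at G x q p z, t >>.
  exact: etrans (congr1 (fun e => << e, t >>) (curv_atC G p q z Ax)) (bilNl _ _ _).
have F p q s : << curv_at G x s (Gam p q) z, t >> = - << curv_at G x (Gam q p) s z, t >>.
  by rewrite (gamma_sym LC q p Ax); exact: C.
exact: cancel E (F u w v) (F v u w) (F w v u).
Qed.

End AtPoint.
End WarpedBianchi.

(** * Null frames *)

Lemma bil_rows (R : realType) m n p (g : 'M[R]_n) (F : 'M[R]_(m, n)) (K : 'M[R]_(p, n)) i j :
  (F *m g *m K^T) i j = bil g (row i F) (row j K).
Proof.
rewrite /bil -row_mul tr_row [LHS]mxE [RHS]mxE.
by apply: eq_bigr => k _; rewrite [in RHS]mxE [X in _ = _ * X]mxE.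
Qed.

Section NullFrame.
Context (R : realType) (g : 'M[R]_4).
Local Notation V := 'rV[R]_4.
Local Notation "<< u , v >>" := (bil g u v).
Hypothesis ug : g \in unitmx.
Hypothesis sg : g^T = g.

Definition null_gram (T N B1 B2 : V) : Prop :=
  [/\ [/\ << T, T >> = 1, << B1, B1 >> = 1, << N, N >> = 0 & << B2, B2 >> = 0],
      << N, B2 >> = 1,
      [/\ << T, N >> = 0, << T, B1 >> = 0 & << T, B2 >> = 0]
    & << N, B1 >> = 0 /\ << B1, B2 >> = 0].

Variables T N B1 B2 : V.
Hypothesis fr : null_gram T N B1 B2.
Let gC u v : << u, v >> = << v, u >> := bilC u v sg.

Lemma null_frame_complete v : << T, v >> = 0 -> << N, v >> = 0 -> << B1, v >> = 0 ->
  << B2, v >> = 0 -> v = 0.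
Proof.
case: fr => -[TT BB NN B2B2] NB2 [TN TB1 TB2] [NB1 B1B2] hT hN hB1 hB2.
pose F : 'M[R]_4 := \matrix_(i < 4) [:: T; N; B1; B2]`_i.
(* The rows of [K] form the dual frame: the null vectors [N] and [B2] trade places because
   [<N, B2> = 1]. *)
pose K : 'M[R]_4 := \matrix_(i < 4) [:: T; B2; B1; N]`_i.
have FK : F *m (g *m K^T) = 1%:M.
  apply/matrixP => i j; rewrite mulmxA bil_rows !rowK [RHS]mxE.
  by case: i => [[|[|[|[|//]]]] ?]; case: j => [[|[|[|[|//]]]] ?] //=;
    rewrite // gC.
have [uF _] := mulmx1_unit FK.
have Fv : F *m (g *m v^T) = 0.
  apply/matrixP => i j; rewrite mulmxA bil_rows rowK ord1 [RHS]mxE.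
  have -> : row 0 v = v by apply/rowP => k; rewrite mxE.
  by case: i => [[|[|[|[|//]]]] ?].
have gv : g *m v^T = 0 by rewrite -[LHS](mulKmx uF) Fv mulmx0.
have v0 : v^T = 0 by rewrite -[LHS](mulKmx ug) gv mulmx0.
by rewrite -[v]trmxK v0 trmx0.
Qed.

Lemma null_frame_norm u : << u, u >> = << T, u >> ^+ 2 + << B1, u >> ^+ 2 + 2 * << N, u >> * << B2, u >>.
Proof.
have /eqP : u - (<< T, u >> *: T + << B1, u >> *: B1 + << B2, u >> *: N + << N, u >> *: B2) = 0.
  case: fr => -[TT BB NN B2B2] NB2 [TN TB1 TB2] [NB1 B1B2].
  apply: null_frame_complete; rewrite !(bilDr, bilNr, bilZr).
  - by rewrite TT TN TB1 TB2; ring.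
  - by rewrite NN NB1 NB2 (gC N T) TN; ring.
  - by rewrite BB B1B2 (gC B1 T) TB1 (gC B1 N) NB1; ring.
  - by rewrite (gC B2 T) TB2 (gC B2 N) NB2 (gC B2 B1) B1B2 B2B2; ring.
rewrite subr_eq0 => /eqP E; rewrite {2}E !(bilDr, bilZr) !(gC u); ring.
Qed.

End NullFrame.

(** * The Bianchi identity on the orthogonal of xi *)

Section WarpedFrame.
Context (R : realType) (M : smooth_manifold R 4) (L : lp_sasakian M) (c : atlas M).
Local Notation V := 'rV[R]_4.
Local Notation A := (cimg (mchart c)).
Local Notation G := (lp_nabla L c).
Local Notation g := (lp_g L c).
Local Notation phi := (lp_phi L c).
Local Notation xi := (lp_xi L c).
Local Notation warp := (warp L c).
Implicit Types (x u v w z : V).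
Hypothesis Hw : forall x, A x -> warped_curv L c x (warp x).
Variable x : V.
Hypothesis Ax : A x.
Local Notation "<< u , v >>" := (bil (g x) u v).
Let sgx := g_sym L Ax.

Let gC u v : << u, v >> = << v, u >> := bilC u v sgx.
Let phiC u v : << u, v *m phi x >> = << v, u *m phi x >>.
Proof. by rewrite -(phi_sym L Ax) gC. Qed.
Let xi_phi v : << xi x, v *m phi x >> = 0.
Proof. by rewrite gC (g_phi_xi L Ax). Qed.

Section Orthonormal.
Variables p q s : V.
Hypotheses (p0 : << p, xi x >> = 0) (q0 : << q, xi x >> = 0) (s0 : << s, xi x >> = 0).
Hypotheses (pp : << p, p >> = 1) (qq : << q, q >> = 1) (ss : << s, s >> = 1).
Hypotheses (pq : << p, q >> = 0) (ps : << p, s >> = 0) (qs : << q, s >> = 0).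

(** Although [h] annihilates [xi], its derivative does not: [(nabla_p h)(xi, p) = - <p, phi p>], and
    likewise for [q]. The term differentiated along [xi] contributes only [d mu], since
    [phi xi = 0]. *)
Lemma warp_xi : 'D_(xi x) warp x = - warp x * (<< p, p *m phi x >> + << q, q *m phi x >>).
Proof.
have := warped_bianchi Hw Ax (xi x) p q q p.
rewrite /nabla_warped /hform_sqr /nabla_hform /hform (phi_xi L Ax) !bil0r !xi_phi (gC q p) !(gC (xi x) p) !(gC (xi x) q).
rewrite (g_xi_xi L Ax) p0 q0 pp qq pq => E; lra.
Qed.

Lemma warp_offdiag : warp x * << q, s *m phi x >> = 0.
Proof.
have := warped_bianchi Hw Ax (xi x) q p p s.
rewrite /nabla_warped /hform_sqr /nabla_hform /hform (phi_xi L Ax) !bil0r !xi_phi !(gC (xi x)) (gC q p).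
rewrite (g_xi_xi L Ax) p0 q0 s0 pp qs pq ps (phiC s q) => E; lra.
Qed.

(** Each term of [nabla_hform] has a factor [eta] of one of its last two arguments and so vanishes
    on horizontal vectors, leaving [d mu]. The plane of [q] and [s] isolates the derivative along
    the third direction [p] of D. *)
Lemma warp_horizontal : 'D_p warp x = 0.
Proof.
have := warped_bianchi Hw Ax p q s s q.
rewrite /nabla_warped /hform_sqr /nabla_hform /hform (gC s q) ?(gC s p) p0 q0 s0 qq ss pq qs ps => E; lra.
Qed.

End Orthonormal.

Variables T N B1 B2 : V.
Hypothesis fr : null_gram (g x) T N B1 B2.
Local Notation a := << T, xi x >>.
Local Notation b := << N, xi x >>.
Local Notation c1 := << B1, xi x >>.
Local Notation d := << B2, xi x >>.

Lemma xi_norm : a ^+ 2 + c1 ^+ 2 + 2 * b * d = -1.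
Proof. by rewrite -(null_frame_norm (g_unit L Ax) sgx fr) g_xi_xi. Qed.

Lemma eta_N_neq0 : b != 0.
Proof.
apply/eqP => b0; have := xi_norm; rewrite b0 => E.
have := sqr_ge0 a; have := sqr_ge0 c1; lra.
Qed.

(* [p], [q], [s] below form an orthonormal basis of the orthogonal of [xi]. *)
Lemma warp_frame : warp x != 0 -> exists eps,
  [/\ eps ^+ 2 = 1, << T, T *m phi x >> = eps * (1 + a ^+ 2),
      << N, T *m phi x >> = eps * a * b, << B1, T *m phi x >> = eps * a * c1
    & 'D_T warp x = 2 * eps * warp x * a].
Proof.
move=> mu0; have b0 := eta_N_neq0.
have [[TT BB NN B2B2] NB2 [TN TB1 TB2] [NB1 B1B2]] := fr.
have [NT B1T B1N] : [/\ << N, T >> = 0, << B1, T >> = 0 & << B1, N >> = 0].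
  by split; rewrite gC.
have xx := g_xi_xi L Ax.
have [xT xN xB] : [/\ << xi x, T >> = a, << xi x, N >> = b & << xi x, B1 >> = c1].
  by split; rewrite gC.
(* [N] is null and orthogonal to [T] and [B1], so subtracting multiples of it removes the
   [eta]-component without altering inner products. For [s], the norm is [2 <N, xi> / b - 1 = 1]. *)
pose p := T - (a / b) *: N; pose q := B1 - (c1 / b) *: N; pose s := b^-1 *: N + xi x.
have p0 : << p, xi x >> = 0 by rewrite /p !(bilDl, bilNl, bilZl); field.
have q0 : << q, xi x >> = 0 by rewrite /q !(bilDl, bilNl, bilZl); field.
have s0 : << s, xi x >> = 0 by rewrite /s !(bilDl, bilNl, bilZl) xx; field.
have pp : << p, p >> = 1.
  by rewrite /p !(bilDl, bilNl, bilZl, bilDr, bilNr, bilZr) TT TN NT NN; ring.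
have qq : << q, q >> = 1.
  by rewrite /q !(bilDl, bilNl, bilZl, bilDr, bilNr, bilZr) BB NB1 B1N NN; ring.
have ss : << s, s >> = 1.
  by rewrite /s !(bilDl, bilNl, bilZl, bilDr, bilNr, bilZr) NN xx xN; field.
have pq : << p, q >> = 0.
  by rewrite /p /q !(bilDl, bilNl, bilZl, bilDr, bilNr, bilZr) TB1 NB1 TN NN; ring.
have ps : << p, s >> = 0.
  by rewrite /p /s !(bilDl, bilNl, bilZl, bilDr, bilNr, bilZr) TN NN; field.
have qs : << q, s >> = 0.
  by rewrite /q /s !(bilDl, bilNl, bilZl, bilDr, bilNr, bilZr) B1N NN; field.
have [qp sp sq] : [/\ << q, p >> = 0, << s, p >> = 0 & << s, q >> = 0].
  by split; rewrite gC.
(* Each of the three planes gives the same derivative [D_xi mu], so the sums of two diagonal entries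
   of [phi] agree and all three entries are equal. *)
have X1 := warp_xi p0 q0 pp qq pq.
have X2 := warp_xi p0 s0 pp ss ps.
have X3 := warp_xi q0 s0 qq ss qs.
have E13 : << p, p *m phi x >> = << s, s *m phi x >>.
  by apply: (mulfI mu0); rewrite X1 !mulrDr in X3; lra.
have E23 : << q, q *m phi x >> = << s, s *m phi x >>.
  by apply: (mulfI mu0); rewrite X1 !mulrDr in X2; lra.
have O u v : warp x * << u, v *m phi x >> = 0 -> << u, v *m phi x >> = 0.
  by move/eqP; rewrite mulf_eq0 (negbTE mu0) => /eqP.
have Oqs := O _ _ (warp_offdiag p0 q0 s0 pp pq ps qs).
have Ops := O _ _ (warp_offdiag q0 p0 s0 qq qp qs ps).
have Opq := O _ _ (warp_offdiag s0 p0 q0 ss sp sq pq).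
have Hp := warp_horizontal p0 q0 s0 qq ss pq ps qs.
have Hs := warp_horizontal s0 p0 q0 pp qq sp sq pq.
have bb : b * b^-1 = 1 by rewrite mulfV.
have TE : T = p + a *: (s - xi x).
  by rewrite /p /s addrK scalerA subrK.
have NE : N = b *: (s - xi x) by rewrite /s addrK scalerA bb scale1r.
have BE : B1 = q + c1 *: (s - xi x).
  by rewrite /q /s addrK scalerA subrK.
clearbody p q s.
pose eps := << p, p *m phi x >>; exists eps.
have Tphi : T *m phi x = p *m phi x + a *: (s *m phi x).
  rewrite {1}TE mulmxDl -scalemxAl mulmxBl.
by rewrite (phi_xi L Ax) subr0.
have S3 : << s, s *m phi x >> = eps by rewrite -E13.
split.
(* The products of [w] with [p], [q], [s] and [xi] all vanish, so its norm is 0; as [phi] is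
   isometric on the orthogonal of [xi], that norm is also [1 - eps^2]. *)
- pose w := p *m phi x - eps *: p.
  have [wp wq ws wx] : [/\ << p, w >> = 0, << q, w >> = 0, << s, w >> = 0 & << xi x, w >> = 0].
    rewrite /w !(bilDr, bilNr, bilZr) pp qp sp xi_phi (gC (xi x)) p0 (phiC s p) (phiC q p) Ops Opq -/eps.
    by split; ring.
  have := null_frame_norm (g_unit L Ax) sgx fr w.
  rewrite {1}TE {1}BE {1}NE !(bilDl, bilNl, bilZl) wp wq ws wx.
  rewrite /w !(bilDl, bilNl, bilZl, bilDr, bilNr, bilZr) (g_phi_phi L Ax) p0 pp (gC _ p) -/eps.
  by move=> E; lra.
- by rewrite Tphi {1}TE !(bilDl, bilNl, bilZl, bilDr, bilZr) !xi_phi (phiC s p) Ops S3 -/eps; ring.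
- by rewrite Tphi {1}NE !(bilDl, bilNl, bilZl, bilDr, bilZr) !xi_phi (phiC s p) Ops S3; ring.
- by rewrite Tphi {1}BE !(bilDl, bilNl, bilZl, bilDr, bilZr) !xi_phi (phiC q p) (phiC s p) Opq Ops Oqs S3; ring.
have dw : differentiable warp x := smooth_differentiable (smooth_warp L c) Ax.
rewrite {1}TE deriveDr // deriveZr // deriveDr // -scaleN1r deriveZr // Hp Hs X1 E23 S3 -/eps.
by rewrite /GRing.scale /=; ring.
Qed.
End WarpedFrame.

(** * Fields along a curve *)

Lemma derive_bil (R : realType) (W : normedModType R) n (g : W -> 'M[R]_n)
    (X Y : W -> 'rV[R]_n) x v :
  differentiable g x -> differentiable X x -> differentiable Y x ->
  'D_v (fun y => bil (g y) (X y) (Y y)) x =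
  bil ('D_v g x) (X x) (Y x) + bil (g x) ('D_v X x) (Y x) + bil (g x) (X x) ('D_v Y x).
Proof.
move=> dg dX dY.
have dXg : differentiable (fun y => X y *m g y) x by exact: differentiable_mulmx.
have dYT : differentiable (fun y => (Y y)^T) x by exact: differentiable_trmx.
have dM : differentiable (fun y => X y *m g y *m (Y y)^T) x by exact: differentiable_mulmx.
rewrite /bil -(derive_mxE _ _ _ dM) (derive_mulmx _ dXg dYT) (derive_mulmx _ dX dg) (derive_trmx _ dY).
rewrite mulmxDl mxE [X in X + _ = _]mxE; congr (_ + _).
by rewrite addrC.
Qed.

Section AlongCurve.
Context (R : realType) (n : nat) (M : smooth_manifold R n) (L : lp_sasakian M) (gam : R -> M)
  (U : set R) (c : atlas M).
Local Notation V := 'rV[R]_n.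
Local Notation A := (cimg (mchart c)).
Local Notation G := (lp_nabla L c).
Local Notation g := (lp_g L c).
Local Notation phi := (lp_phi L c).
Local Notation xi := (lp_xi L c).
Local Notation x := (coords gam c).
Local Notation T := (velocity gam c).
Hypothesis oU : open U.
Hypothesis hgam : smooth_curve gam U.
Let D : set R^o := U `&` in_chart gam c.
Implicit Types (t : R) (X Y : atlas M -> R -> V).

Lemma curve_domain_open : open D.
Proof.
rewrite openE => t [Ut It]; rewrite /interior.
have H1 : nbhs t U by exact: (open_nbhs_nbhs (conj oU Ut)).
have H2 : nbhs t (in_chart gam c).
  have cg : {for t, continuous gam} by case: hgam => + _; apply.
  by apply: cg; apply: open_nbhs_nbhs; split=> //; exact: cdom_open.
exact: filterI H1 H2.
Qed.
Let oD := curve_domain_open.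

Lemma coords_cimg t : D t -> A (x t).
Proof. by move=> [_ It]; exists (gam t). Qed.

Lemma smooth_coords : smooth_on D x.
Proof. by case: hgam => _; apply. Qed.

Lemma smooth_velocity : smooth_on D T.
Proof.
apply: (eq_smooth oD _ (smooth_derive (1 : R^o) smooth_coords)) => t _.
by rewrite /velocity derive1E.
Qed.

Lemma smooth_comp_coords m p (F : V -> 'M[R]_(m, p)) : smooth_on A F ->
  smooth_on D (F \o x).
Proof.
move=> sF; apply/(smooth_mxP oD) => i j k.
apply: (Ck_comp oD (@open_cimg R n M c) coords_cimg (f := fun y => F y i j)).
  exact: smooth_coords.
exact: (smooth_entry (@open_cimg R n M c) _ _ sF).
Qed.

Lemma smooth_cov_along X : smooth_on D (X c) -> smooth_on D (cov_along L gam X c).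
Proof.
move=> sX; apply: smoothD => //.
  apply: (eq_smooth oD _ (smooth_derive (1 : R^o) sX)) => t _.
  by rewrite derive1E.
apply: (@smooth_gamma R R^o D oD n (fun t => G (x t))) => //; last exact: smooth_velocity.
move=> i j; exact: (smooth_comp_coords (smooth_G L c i j)).
Qed.

Lemma derive_coords_comp m p (F : V -> 'M[R]_(m, p)) t : smooth_on A F -> D t ->
  'D_(1 : R^o) (F \o x : R^o -> _) t = 'D_(T t) F (x t).
Proof.
move=> sF Dt; rewrite derive_comp.
- by rewrite /velocity derive1E.
- exact: smooth_differentiable smooth_coords Dt.
- exact: smooth_differentiable sF (coords_cimg Dt).
Qed.

(** Metric compatibility applied to the constant extensions of [X c t] and [Y c t] expresses the
    derivative of [g] along the velocity; the Leibniz rule supplies the derivatives of the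
    components. *)
Lemma derive_inner X Y t : smooth_on D (X c) -> smooth_on D (Y c) -> D t ->
  'D_(1 : R^o) (fun t : R^o => bil (g (x t)) (X c t) (Y c t)) t =
  bil (g (x t)) (cov_along L gam X c t) (Y c t) + bil (g (x t)) (X c t) (cov_along L gam Y c t).
Proof.
move=> sX sY Dt.
have dX := smooth_differentiable sX Dt; have dY := smooth_differentiable sY Dt.
have dg := smooth_differentiable (smooth_comp_coords (smooth_g L c)) Dt.
have LC := lp_nabla_levi_civita L c.
have Ax := coords_cimg Dt.
have dgx := smooth_differentiable (smooth_g L c) Ax.
have := lc_derive LC (cst (T t)) (smooth_cst A (X c t)) (smooth_cst A (Y c t)) Ax.
rewrite !cov_cst (derive_bil _ dgx (differentiable_cst _ _) (differentiable_cst _ _)).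
rewrite !derive_cst bil0l bil0r !addr0 /= => compat.
rewrite (derive_bil _ dg dX dY) (_ : 'D_1 _ t = 'D_(T t) g (x t)); last first.
  exact: (derive_coords_comp (smooth_g L c) Dt).
rewrite compat /cov_along !derive1E bilDl bilDr; ring.
Qed.

Lemma cov_along_field X (F : V -> V) t : smooth_on A F -> X c = F \o x -> D t ->
  cov_along L gam X c t = cov G (cst (T t)) F (x t).
Proof. by move=> sF EX Dt; rewrite /cov_along EX derive1E (derive_coords_comp sF Dt). Qed.

Lemma derive_eta_along X t : smooth_on D (X c) -> D t ->
  'D_(1 : R^o) (fun t : R^o => bil (g (x t)) (X c t) (xi (x t))) t =
  bil (g (x t)) (cov_along L gam X c t) (xi (x t)) + bil (g (x t)) (X c t) (T t *m phi (x t)).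
Proof.
move=> sX Dt.
have := @derive_inner X (fun c t => lp_xi L c (coords gam c t)) t sX (smooth_comp_coords (smooth_xi L c)) Dt.
rewrite /= => ->; congr (_ + bil _ _ _).
by rewrite (cov_along_field (smooth_xi L c) _ Dt) // cov_xi //; exact: coords_cimg.
Qed.

Lemma differentiable_eta_along X t : smooth_on D (X c) -> D t ->
  differentiable (fun t : R^o => bil (g (x t)) (X c t) (xi (x t)) : R) t.
Proof.
move=> sX Dt; apply: (smooth_differentiable _ Dt).
apply: (smooth_bil oD) => //; [exact: (smooth_comp_coords (smooth_g L c))|].
exact: (smooth_comp_coords (smooth_xi L c)).
Qed.

End AlongCurve.

(** * The differential system for the components of xi *)

Section NullFrenetODE.
Context (R : realType) (J : set R^o) (a b c d k2 k3 mu : R^o -> R).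
Hypothesis oJ : open J.
Local Notation D1 f := ('D_(1 : R^o) f).
Hypothesis da : forall t, J t -> differentiable a t.
Hypothesis dda : forall t, J t -> differentiable (D1 a) t.
Hypothesis db : forall t, J t -> differentiable b t.
Hypothesis dc : forall t, J t -> differentiable c t.
Hypothesis dk2 : forall t, J t -> differentiable k2 t.
Hypothesis dmu : forall t, J t -> differentiable mu t.
Hypothesis b_neq0 : forall t, J t -> b t != 0.
Hypothesis norm1 : forall t, J t -> a t ^+ 2 + c t ^+ 2 + 2 * b t * d t = -1.
Hypothesis k2_sqr : forall t, J t -> k2 t ^+ 2 = mu t * b t ^+ 2.
Hypothesis k2_deriv : forall t, J t -> D1 k2 t = - mu t * b t * c t.
Hypothesis k2_k3 : forall t, J t -> k2 t * k3 t = -1 - mu t * (1 + b t * d t + a t ^+ 2).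
Hypothesis frame : forall t, J t -> mu t != 0 -> exists eps,
  [/\ eps ^+ 2 = 1, D1 a t = b t + eps * (1 + a t ^+ 2),
      D1 b t = k2 t * c t + eps * a t * b t,
      D1 c t = k3 t * b t - k2 t * d t + eps * a t * c t
    & D1 mu t = 2 * eps * mu t * a t].

Lemma null_ode_mu_neq0 t : J t -> mu t != 0.
Proof.
move=> Jt; apply/eqP => mu0; have := k2_sqr Jt; rewrite mu0 mul0r => /eqP.
rewrite sqrf_eq0 => /eqP k0; have := k2_k3 Jt; rewrite k0 mu0 => E; lra.
Qed.

Lemma null_ode_flow t : J t -> exists eps,
  [/\ eps ^+ 2 = 1, D1 a t = b t + eps * (1 + a t ^+ 2), k2 t * c t = - eps * a t * b t,
      D1 b t = 0 & D1 c t = k3 t * b t - k2 t * d t + eps * a t * c t].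
Proof.
move=> Jt; have mu0 := null_ode_mu_neq0 Jt.
have [eps [e2 Ea Eb Ec Emu]] := frame Jt mu0; exists eps.
have kk : 'D_(1 : R^o) (fun t => k2 t * k2 t) t = 'D_(1 : R^o) (fun t => mu t * (b t * b t)) t.
  by apply: (eq_on_derive _ oJ) => // s Js; rewrite -!expr2; exact: k2_sqr.
have dbb := differentiableM (db Jt) (db Jt).
rewrite (deriveMf _ (dk2 Jt) (dk2 Jt)) (deriveMf _ (dmu Jt) dbb) (deriveMf _ (db Jt) (db Jt)) in kk.
have kc : k2 t * c t = - eps * a t * b t.
  (* The two sides of the derived relation [kk] differ by [4 mu b (k2 c + eps a b)], up to sign. *)
  have : mu t * b t * (k2 t * c t + eps * a t * b t) = 0.
    move: kk; rewrite mulrfctE k2_deriv // Emu Eb => kk; lra.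
  by move/eqP; rewrite mulf_eq0 mulf_eq0 (negbTE mu0) (negbTE (b_neq0 Jt)) => /eqP E; lra.
by split => //; rewrite Eb kc; ring.
Qed.

Lemma null_ode_contradiction t : J t -> False.
Proof.
move=> Jt; pose e s := (D1 a s - b s) / (1 + a s * a s).
have pos s : 1 + a s * a s != 0 by rewrite gt_eqF // ltr_wpDr // -expr2 sqr_ge0.
have eE s : J s -> e s ^+ 2 = 1 /\ k2 s * c s = - e s * a s * b s.
  move=> Js; have [eps [e2 Ea kc _ _]] := null_ode_flow Js.
  have -> : e s = eps by rewrite /e Ea expr2 addrC addKr mulfK.
  by [].
have [eps [e2 Ea kc Eb Ec]] := null_ode_flow Jt.
have et : e t = eps by rewrite /e Ea expr2 addrC addKr mulfK.
have d1a : differentiable (fun s => 1 + a s * a s) t.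
  exact: differentiableD (differentiable_cst _ _) (differentiableM (da Jt) (da Jt)).
have de : differentiable e t.
  exact: differentiableM (differentiableB (dda Jt) (db Jt)) (differentiableV d1a (pos t)).
have e0 : D1 e t = 0.
  have : 'D_(1 : R^o) (fun s => e s * e s) t = 'D_(1 : R^o) (cst (1 : R)) t.
    by apply: (eq_on_derive _ oJ) => // s Js; rewrite -expr2; exact: (eE s Js).1.
  rewrite (deriveMf _ de de) derive_cst et; move: (D1 e t) => y E.
  have z : eps * y = 0 by lra.
  by rewrite -[y]mul1r -e2 expr2 -mulrA z mulr0.
have kcE : 'D_(1 : R^o) (fun s => k2 s * c s) t = 'D_(1 : R^o) (fun s => - 1 *: (e s * (a s * b s))) t.
  by apply: (eq_on_derive _ oJ) => // s Js; rewrite (eE s Js).2 scaleN1r -!mulNr mulrA.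
have dab := differentiableM (da Jt) (db Jt).
have deab := differentiableM de dab.
rewrite (deriveMf _ (dk2 Jt) (dc Jt)) in kcE.
move: kcE; rewrite [in RHS]deriveZ; last exact: diff_derivable.
rewrite (deriveMf _ de dab) (deriveMf _ (da Jt) (db Jt)) e0 et Eb k2_deriv // Ec Ea mul0r mulr0 addr0 add0r.
have E1 := k2_sqr Jt; have E3 := k2_k3 Jt; have E0 := norm1 Jt.
rewrite scaleN1r => H.
have : eps * b t ^+ 2 = 0.
  (* The first bracket vanishes by the derived relation [H]. The multiples of the other relations
     eliminate [mu c^2], [k2 k3], [k2^2], [k2 c] and [eps^2], in this order. *)
  rewrite [LHS](_ : _ =
    (- mu t * b t * c t * c t + k2 t * (k3 t * b t - k2 t * d t + eps * a t * c t)
      + eps * ((b t + eps * (1 + a t ^+ 2)) * b t))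
    + mu t * b t * (a t ^+ 2 + c t ^+ 2 + 2 * b t * d t + 1)
    - b t * (k2 t * k3 t - (-1 - mu t * (1 + b t * d t + a t ^+ 2)))
    + d t * (k2 t ^+ 2 - mu t * b t ^+ 2)
    - eps * a t * (k2 t * c t - - eps * a t * b t) - b t * (eps ^+ 2 - 1)); last by ring.
  by rewrite H E0 E1 E3 kc e2; ring.
move/eqP; rewrite mulf_eq0 sqrf_eq0 (negbTE (b_neq0 Jt)) orbF => /eqP eps0.
by move: e2; rewrite eps0 expr0n /= => /eqP; rewrite eq_sym oner_eq0.
Qed.

End NullFrenetODE.

(* [t] may be an endpoint of [I]: the difference quotients of [f] vanish along a
   sequence of increments tending to [0]. *)
Lemma derive_interval_eq0 (R : realType) (W : normedModType R) (I : set R) (D : set R^o)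
    (f : R^o -> W) (t s : R) :
  is_interval I -> I t -> I s -> s != t -> open D -> D t ->
  (forall u, I u -> D u -> f u = 0) -> differentiable f t -> 'D_(1 : R^o) f t = 0.
Proof.
move=> II It Is st oD Dt f0 /(@diff_derivable _ _ _ _ _ (1 : R^o)) df.
apply/eqP; rewrite -normr_le0; apply/ler_addgt0Pl => e e0; rewrite addr0.
have near1 : \forall h \near (0 : R), h != 0 ->
    `|'D_(1 : R^o) f t - h^-1 *: (f (h *: (1 : R^o) + t) - f t)| < e.
  by have /cvgrPdist_lt/(_ e e0) := df.
have near2 : \forall h \near (0 : R), D (h + t).
  have H : \forall h \near t, D h by exact: (open_nbhs_nbhs (conj oD Dt)).
  by move: H; rewrite (near_shift 0) subr0.
have near12 : \forall h \near (0 : R), (h != 0 ->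
    `|'D_(1 : R^o) f t - h^-1 *: (f (h *: (1 : R^o) + t) - f t)| < e) /\ D (h + t).
  exact: filterI near1 near2.
have /nbhs_normP[r /= r0 Hr] := near12.
(* The bound 1 keeps [h + t] between [t] and [s], hence in [I]; the other bound, with its factor 2,
   makes the increment strictly smaller than [r]. *)
pose del := Num.min 1 (r / (2 * `|s - t|)).
pose h := del * (s - t).
have st0 : 0 < `|s - t| by rewrite normr_gt0 subr_eq0.
have del0 : 0 < del by rewrite lt_min ltr01 divr_gt0 // mulr_gt0.
have del1 : del <= 1 by rewrite ge_min lexx.
have hr : `|0 - h| < r.
  rewrite sub0r normrN normrM gtr0_norm //.
  apply: (@le_lt_trans _ _ (r / (2 * `|s - t|) * `|s - t|)).
    by apply: ler_wpM2r => //; rewrite ge_min lexx orbT.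
  rewrite invfM mulrA mulfVK ?gt_eqF // gtr_pMr // invf_lt1 //; lra.
have h0 : h != 0 by apply: mulf_neq0; [rewrite gt_eqF|rewrite subr_eq0].
have [/(_ h0) H1 H2] := Hr h hr.
have Ih : I (h + t).
  have [ts|ts] := leP t s.
    apply: (II t s) => //; rewrite /h; have : 0 <= s - t by rewrite subr_ge0.
    by move=> H; apply/andP; split; nra.
  apply: (II s t) => //; rewrite /h; have : 0 <= t - s by rewrite subr_ge0 ltW.
  by move=> H; apply/andP; split; nra.
move: H1; rewrite [h *: _]mulr1 (f0 _ Ih H2) (f0 _ It Dt) subr0 scaler0 subr0.
exact: ltW.
Qed.

(** * Geodesics are biharmonic *)

Section GeodesicBiharmonic.
Context (R : realType) (n : nat) (M : smooth_manifold R n) (L : lp_sasakian M) (gam : R -> M)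
  (I U : set R).
Hypothesis II : is_interval I.
Hypothesis I2 : exists s t : R, I s /\ I t /\ s < t.
Hypothesis oU : open U.
Hypothesis IU : I `<=` U.
Hypothesis hgam : smooth_curve gam U.

(** [X] vanishes on [I] only, while [derive1] also sees the extension to [U]. A second point of [I]
    provides increments inside [I], which determine the derivative even at an endpoint. *)
Lemma cov_along_eq0 (X : atlas M -> R -> 'rV[R]_n) c t :
  smooth_on (U `&` in_chart gam c : set R^o) (X c) ->
  (forall u, I u -> in_chart gam c u -> X c u = 0) -> I t -> in_chart gam c t ->
  cov_along L gam X c t = 0.
Proof.
move=> sX X0 It ct; rewrite /cov_along X0 // gamma0r addr0 derive1E.
have [s [Is st]] : exists s, I s /\ s != t.
  have [p [q [Ip [Iq pq]]]] := I2.
  have [pt|pt] := eqVneq p t; last by exists p.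
  by exists q; split=> //; rewrite -pt gt_eqF.
have Dt : (U `&` in_chart gam c) t by split=> //; exact: IU.
have f0 u : I u -> (U `&` in_chart gam c) u -> X c u = 0 by move=> Iu [_ cu]; exact: X0.
have H := (@derive_interval_eq0 R _ I (U `&` in_chart gam c) (X c) t s II It Is st
  (curve_domain_open oU hgam) Dt f0 (smooth_differentiable sX Dt)).
exact: H.
Qed.

Lemma geodesic_biharmonic : geodesic L gam I -> biharmonic L gam I.
Proof.
move=> geo c t It ct.
have s0 : smooth_on (U `&` in_chart gam c : set R^o) (velocity gam c) by exact: smooth_velocity.
have s1 := smooth_cov_along L oU hgam (X := velocity gam) s0.
have s2 := smooth_cov_along L oU hgam (X := cov_along L gam (velocity gam)) s1.
have z1 u : I u -> in_chart gam c u -> cov_along L gam (velocity gam) c u = 0.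
  exact: geo.
have z2 u : I u -> in_chart gam c u -> cov_along L gam (cov_along L gam (velocity gam)) c u = 0.
  by move=> Iu cu; exact: cov_along_eq0 s1 z1 Iu cu.
rewrite /zero_along (cov_along_eq0 s2 z2 It ct) sub0r /curv_along z1 //.
have Ax : cimg (mchart c) (coords gam c t) by apply: (@coords_cimg _ _ _ _ U); split=> //; exact: IU.
have := curvZm (@open_cimg R n M c) (smooth_G L c) Ax 0 (velocity gam c t) 0 (velocity gam c t).
by rewrite !scale0r => ->; rewrite oppr0.
Qed.

End GeodesicBiharmonic.

(** * Curves with first curvature 1 *)

Section CovariantAlong.
Context (R : realType) (n : nat) (M : smooth_manifold R n) (L : lp_sasakian M) (gam : R -> M)
  (c : atlas M).

Lemma eq_cov_along (J : set R^o) (X Y : atlas M -> R -> 'rV[R]_n) t : open J ->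
  (forall u, J u -> X c u = Y c u) -> J t -> cov_along L gam X c t = cov_along L gam Y c t.
Proof.
move=> oJ XY Jt; rewrite /cov_along !derive1E.
by rewrite (eq_on_derive (f := X c : R^o -> _) (g := Y c) 1 oJ XY Jt) (XY t Jt).
Qed.

Lemma cov_along_scale (f : R -> R) (X : atlas M -> R -> 'rV[R]_n) t :
  differentiable (f : R^o -> R) t -> differentiable (X c : R^o -> _) t ->
  cov_along L gam (scale_along f X) c t =
  'D_(1 : R^o) (f : R^o -> R) t *: X c t + f t *: cov_along L gam X c t.
Proof.
move=> df dX; rewrite /cov_along /scale_along !derive1E gammaZr scalerDr addrA.
by congr (_ + _); exact: (derive_scalemx (1 : R^o) df dX).
Qed.

End CovariantAlong.

Section NonGeodesic.
Context (R : realType) (M : smooth_manifold R 4) (L : lp_sasakian M) (gam : R -> M) (I U : set R)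
  (N B1 B2 : atlas M -> R -> 'rV[R]_4) (k1 k2 k3 : R -> R).
Hypothesis hM : conformally_flat L \/ quasi_conformally_flat L \/ conformally_symmetric L.
Hypothesis II : is_interval I.
Hypothesis I2 : exists s t : R, I s /\ I t /\ s < t.
Hypothesis oU : open U.
Hypothesis IU : I `<=` U.
Hypothesis hgam : smooth_curve gam U.
Hypothesis fr : null_frenet_frame L gam I U N B1 B2 k1 k2 k3.
Local Notation T := (velocity gam).

Lemma non_geodesic_not_biharmonic : (forall t, I t -> k1 t = 1) -> ~ biharmonic L gam I.
Proof.
move=> k11 bih.
have [p [q [Ip [Iq pq]]]] := I2.
have [m pm mq] : exists2 m, p < m & m < q.
  by exists ((p + q) / 2); lra.
have [c cm] := atlas_cover (gam m).
pose D : set R^o := U `&` in_chart gam c.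
have oD : open D by exact: curve_domain_open oU hgam.
(* On this open set the Frenet equations are identities between functions and may be differentiated;
   [m] is taken strictly between two points of [I] so that [J] is nonempty. *)
pose J : set R^o := [set t | p < t < q] `&` D.
have IJ t : p < t < q -> I t.
  by move=> /andP[pt tq]; apply: (II Ip Iq); rewrite !ltW.
have oJ : open J.
  apply: openI => //; rewrite (_ : [set t | _] = `]p, q[%classic); first exact: interval_open.
  by apply/seteqP; split=> t; rewrite /= in_itv.
have Jm : J m.
  by split; [rewrite /= pm mq|split=> //; apply/IU/IJ; rewrite pm mq].
have JI t : J t -> I t by case=> /IJ.
have JD t : J t -> D t by case.
have Jc t : J t -> in_chart gam c t by move=> /JD [].
have Hw := warped_of_flatness (c := c) hM.
have Ax t : J t -> cimg (mchart c) (coords gam c t) by move=> /JD; exact: coords_cimg.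
have sT : smooth_on D (T c) by exact: smooth_velocity.
have sN : smooth_on D (N c) by have [+ _] := frenet_N fr; apply.
have sB1 : smooth_on D (B1 c) by have [+ _] := frenet_B1 fr; apply.
have sB2 : smooth_on D (B2 c) by have [+ _] := frenet_B2 fr; apply.
have dk2 t : J t -> differentiable (k2 : R^o -> R) t.
  by move=> [_ [Ut _]]; exact: (smooth_differentiable (frenet_k2 fr) Ut).
have eT t : J t -> cov_along L gam T c t = N c t.
  move=> Jt; rewrite (frenet_dT fr (JI _ Jt) (Jc _ Jt)) /scale_along k11 ?scale1r //.
  exact: JI.
have eN t : J t -> cov_along L gam N c t = k2 t *: B1 c t.
  by move=> Jt; exact: (frenet_dN fr (JI _ Jt) (Jc _ Jt)).
have eB1 t : J t -> cov_along L gam B1 c t = k3 t *: N c t + - k2 t *: B2 c t.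
  by move=> Jt; exact: (frenet_dB1 fr (JI _ Jt) (Jc _ Jt)).
have e2 t : J t -> cov_along L gam (cov_along L gam T) c t = scale_along k2 B1 c t.
  by move=> Jt; rewrite (eq_cov_along L gam (Y := N) oJ eT Jt) eN.
have e3 t : J t -> cov_along L gam (cov_along L gam (cov_along L gam T)) c t =
    'D_(1 : R^o) (k2 : R^o -> R) t *: B1 c t + k2 t *: (k3 t *: N c t + - k2 t *: B2 c t).
  move=> Jt; rewrite (eq_cov_along L gam (Y := scale_along k2 B1) oJ e2 Jt).
  rewrite cov_along_scale ?eB1 //; first exact: dk2.
  exact: smooth_differentiable sB1 (JD _ Jt).
have bi t : J t -> curv_at (lp_nabla L c) (coords gam c t) (T c t) (N c t) (T c t) =
    'D_(1 : R^o) (k2 : R^o -> R) t *: B1 c t + k2 t *: (k3 t *: N c t + - k2 t *: B2 c t).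
  move=> Jt; have := bih c t (JI _ Jt) (Jc _ Jt).
  rewrite e3 // /curv_along eT // /zero_along => /eqP.
  by rewrite subr_eq0 => /eqP.
pose g t := lp_g L c (coords gam c t).
pose ip t u v := bil (g t) u v.
pose xi t := lp_xi L c (coords gam c t).
pose a (t : R^o) : R := ip t (T c t) (xi t).
pose b (t : R^o) : R := ip t (N c t) (xi t).
pose c1 (t : R^o) : R := ip t (B1 c t) (xi t).
pose d (t : R^o) : R := ip t (B2 c t) (xi t).
pose mu (t : R^o) : R := warp L c (coords gam c t).
have gram t : J t -> null_gram (g t) (T c t) (N c t) (B1 c t) (B2 c t).
  move=> Jt; have It := JI _ Jt; have ct := Jc _ Jt.
  split; [split|exact: (frenet_NB2 fr)|split|split].
  - exact: (frenet_TT fr).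
  - exact: (frenet_B1B1 fr).
  - exact: (frenet_NN fr).
  - exact: (frenet_B2B2 fr).
  - exact: (frenet_TN fr).
  - exact: (frenet_TB1 fr).
  - exact: (frenet_TB2 fr).
  - exact: (frenet_NB1 fr).
  - exact: (frenet_B1B2 fr).
have ipC t u v : J t -> ip t u v = ip t v u.
  by move=> Jt; apply: bilC; exact: (g_sym L (Ax _ Jt)).
have biz t z : J t -> ip t (N c t) (T c t) * ip t (T c t) z - ip t (T c t) (T c t) * ip t (N c t) z
    + mu t * (hform L c (coords gam c t) (N c t) (T c t) * hform L c (coords gam c t) (T c t) z
      - hform L c (coords gam c t) (T c t) (T c t) * hform L c (coords gam c t) (N c t) z) =
    'D_(1 : R^o) (k2 : R^o -> R) t * ip t (B1 c t) z
    + k2 t * (k3 t * ip t (N c t) z - k2 t * ip t (B2 c t) z).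
  move=> Jt; have := bil_warped Hw (T c t) (N c t) (T c t) z (Ax _ Jt).
  by rewrite bi // bilDl !bilZl bilDl !bilZl mulNr => <-.
have sa : smooth_on D a.
  apply: (smooth_bil oD) => //; first exact: (smooth_comp_coords oU hgam (smooth_g L c)).
  exact: (smooth_comp_coords oU hgam (smooth_xi L c)).
have da t : J t -> differentiable a t.
  by move=> Jt; exact: smooth_differentiable sa (JD _ Jt).
have dda t : J t -> differentiable ('D_(1 : R^o) a) t.
  by move=> Jt; exact: smooth_differentiable (smooth_derive _ sa) (JD _ Jt).
have dsm X t : smooth_on D (X c) -> J t -> differentiable (fun t : R^o => ip t (X c t) (xi t) : R) t.
  by move=> sX Jt; exact: (differentiable_eta_along L oU hgam sX (JD _ Jt)).
have dmu t : J t -> differentiable mu t.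
  move=> Jt; apply: (differentiable_comp (g := warp L c)).
    exact: (smooth_differentiable (smooth_coords c hgam) (JD _ Jt)).
  exact: (smooth_differentiable (smooth_warp L c) (Ax _ Jt)).
have TT1 t : J t -> ip t (T c t) (T c t) = 1 by move=> /gram [[]].
have NT0 t : J t -> ip t (N c t) (T c t) = 0.
  by move=> Jt; have [_ _ [H _ _] _] := gram _ Jt; rewrite ipC.
have bz t z : J t -> - ip t (N c t) z
    + mu t * (b t * a t * (ip t (T c t) z + a t * ip t z (xi t))
      - (1 + a t ^+ 2) * (ip t (N c t) z + b t * ip t z (xi t))) =
    'D_(1 : R^o) (k2 : R^o -> R) t * ip t (B1 c t) z
    + k2 t * (k3 t * ip t (N c t) z - k2 t * ip t (B2 c t) z).
  move=> Jt; rewrite -(biz t z Jt) NT0 // TT1 // /hform -/(ip t _ _).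
  rewrite -!/(ip t _ _) NT0 // TT1 // -/(a t) -/(b t); ring.
apply: (@null_ode_contradiction R J a b c1 d k2 k3 mu oJ da dda _ _ dk2 dmu _ _ _ _ _ _ m Jm).
- by move=> t; exact: dsm.
- by move=> t; exact: dsm.
- by move=> t Jt; exact: (eta_N_neq0 (Ax _ Jt) (gram _ Jt)).
- by move=> t Jt; exact: (xi_norm (Ax _ Jt) (gram _ Jt)).
(* Duality of the null pair: pairing the biharmonic equation with [N] reads off its [B2]-component,
   which gives [k2^2]. Below, [B1] yields the derivative of [k2], and [B2] the [N]-component
   [k2 k3]. *)
- move=> t Jt; have := bz t (N c t) Jt; have [[_ _ NN _] NB2 [TN _ _] [NB1 _]] := gram _ Jt.
  rewrite [ip t (N c t) (N c t)]NN [ip t (T c t) _]TN (ipC t (B1 c t)) // [ip t (N c t) (B1 c t)]NB1.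
  rewrite (ipC t (B2 c t)) // [ip t (N c t) (B2 c t)]NB2 -/(b t).
  by move=> E; lra.
- move=> t Jt; have := bz t (B1 c t) Jt; have [[_ BB _ _] _ [_ TB1 _] [NB1 B12]] := gram _ Jt.
  rewrite [ip t (N c t) (B1 c t)]NB1 [ip t (T c t) _]TB1 [ip t (B1 c t) (B1 c t)]BB (ipC t (B2 c t)) //.
  rewrite [ip t (B1 c t) (B2 c t)]B12 -/(c1 t).
  by move=> E; lra.
- move=> t Jt; have := bz t (B2 c t) Jt; have [[_ _ _ BB] NB2 [_ _ TB2] [_ B12]] := gram _ Jt.
  rewrite [ip t (N c t) (B2 c t)]NB2 [ip t (T c t) _]TB2 [ip t (B2 c t) (B2 c t)]BB [ip t (B1 c t) (B2 c t)]B12 -/(d t).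
  by move=> E; lra.
move=> t Jt mu0.
have [eps [e_2 ET EN EB Emu]] := warp_frame Hw (Ax _ Jt) (gram _ Jt) mu0; exists eps.
have dX X (sX : smooth_on D (X c)) := derive_eta_along L oU hgam sX (JD _ Jt).
split=> //.
- have := dX T sT; rewrite eT // ET; exact.
- have := dX N sN; rewrite eN // bilZl EN; exact.
- have := dX B1 sB1; rewrite eB1 // bilDl !bilZl mulNr EB; exact.
- rewrite /mu -[X in 'D_1 X t]/(warp L c \o coords gam c) derive_comp.
  + by rewrite -Emu /velocity derive1E.
  + exact: (smooth_differentiable (smooth_coords c hgam) (JD _ Jt)).
  + exact: (smooth_differentiable (smooth_warp L c) (Ax _ Jt)).
Qed.

End NonGeodesic.

Theorem theorem3p5 (R : realType) (M : smooth_manifold R 4)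
    (L : lp_sasakian M)
    (hM : conformally_flat L \/ quasi_conformally_flat L \/
          conformally_symmetric L)
    (I U : set R)
    (hI : is_interval I) (hI2 : exists s t : R, I s /\ I t /\ s < t)
    (hU : open U) (hIU : I `<=` U)
    (gam : R -> M)
    (hgam : smooth_curve gam U)
    (hunit : spacelike_unit_speed L gam I)
    (N B1 B2 : atlas M -> R -> 'rV[R]_4) (k1 k2 k3 : R -> R)
    (hframe : null_frenet_frame L gam I U N B1 B2 k1 k2 k3)
    (hconv : first_curvature_convention L gam I k1) :
  biharmonic L gam I <-> geodesic L gam I.
Proof.
split; last exact: (geodesic_biharmonic hI hI2 hU hIU hgam).
move=> bih; have [//|ngeo] := pselect (geodesic L gam I).
have [_ /(_ ngeo) k11] := hconv.
by have := non_geodesic_not_biharmonic hM hI hI2 hU hIU hgam hframe k11 bih.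
Qed.
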